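(* Let $(\mathbf F_n)_{n\in\mathbb N}$ be a sequence of finite (colored) mappings with $\lim_{n\to\infty}|F_n|=\infty$ which is ${\rm FO}$-convergent. Then there exists a modeling mapping $\mathbf L$ which is an ${\rm FO}$-limit of $(\mathbf F_n)_{n\in\mathbb N}$ (i.e. $\langle\phi,\mathbf L\rangle=\lim_{n\to\infty}\langle\phi,\mathbf F_n\rangle$ for every first-order formula $\phi$) and such that: (1) the probability measure $\nu_{\mathbf L}$ is atomless, i.e. $\nu_{\mathbf L}(\{v\})=0$ for every $v\in L$; (2) the complete theory of $\mathbf L$ has the finite model property, i.e. for every first-order sentence $\theta$ with $\mathbf L\models\theta$ there exists a finite mapping $\mathbf F$ with $\mathbf F\models\theta$; (3) $\mathbf L$ satisfies the finitary mass transport principle.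
   Context: A (colored) mapping is a structure $\mathbf F$ in a signature $\sigma$ consisting of one unary function symbol $f$ and finitely many unary relation symbols $M_1,\dots,M_c$; its domain is $F$ and $f_{\mathbf F}:F\to F$ interprets $f$. For a first-order formula $\phi$ with $p$ free variables, $\phi(\mathbf F)=\{(v_1,\dots,v_p)\in F^p:\mathbf F\models\phi(v_1,\dots,v_p)\}$. For finite $\mathbf F$, $\langle\phi,\mathbf F\rangle=|\phi(\mathbf F)|/|F|^p$. If $F$ is a standard Borel space with a Borel probability measure $\nu_{\mathbf F}$ and $\phi(\mathbf F)$ is Borel, $\langle\phi,\mathbf F\rangle=\nu_{\mathbf F}^{\otimes p}(\phi(\mathbf F))$. Such an $\mathbf F$ is a Borel mapping if $f_{\mathbf F}$ is Borel measurable, and a modeling mapping if every first-order definable set $\phi(\mathbf F)\subseteq F^p$ is Borel. A sequence of finite mappings is ${\rm FO}$-convergent if $\lim_n\langle\phi,\mathbf F_n\rangle$ exists for every first-order formula $\phi$. For a modeling mapping $\mathbf F$, let $F_\infty=\{x\in F:|f_{\mathbf F}^{-1}(x)|=\infty\}$. $\mathbf F$ satisfies the finitary mass transport principle if $\nu_{\mathbf F}(F_\infty)=0$ and for all measurable $A,B\subseteq F\setminus F_\infty$ one has $\nu_{\mathbf F}(A\cap f_{\mathbf F}^{-1}(B))=\int_B|f_{\mathbf F}^{-1}(y)\cap A|\,{\rm d}\nu_{\mathbf F}(y)$. *)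

(* Defs.v *)
From HB Require Import structures.
From mathcomp Require Import all_boot all_order all_algebra.
From mathcomp Require Import all_classical all_reals all_analysis.

Set Implicit Arguments.
Unset Strict Implicit.
Unset Printing Implicit Defensive.

Import Order.TTheory GRing.Theory Num.Theory.
Import numFieldNormedType.Exports.

Local Open Scope classical_set_scope.
Local Open Scope ring_scope.

Record mapping (c : nat) (T : Type) := Mapping {
  mfn : T -> T;
  mmark : 'I_c -> set T
}.

Inductive term (p : nat) : Type :=
| TVar of 'I_p
| TApp of term p.

(* [formula c p] is the type of first-order formulas, with equality, whose free
   variables are among p variables (de Bruijn style: the variable bound by
   [FEx] has index 0).  The connectives left out are definable. *)
Inductive formula (c : nat) : nat -> Type :=
| FEq p of term p & term p : formula c p
| FMark p of 'I_c & term p : formula c p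
| FNot p of formula c p : formula c p
| FAnd p of formula c p & formula c p : formula c p
| FEx p of formula c p.+1 : formula c p.

Fixpoint term_eval (c : nat) (T : Type) (M : mapping c T) (p : nat)
    (v : p.-tuple T) (t : term p) : T :=
  match t with
  | TVar i => tnth v i
  | TApp t' => mfn M (term_eval M v t')
  end.

Fixpoint sat (c : nat) (T : Type) (M : mapping c T) (p : nat)
    (phi : formula c p) {struct phi} : p.-tuple T -> Prop :=
  match phi in formula _ q return q.-tuple T -> Prop with
  | FEq _ t1 t2 => fun v => term_eval M v t1 = term_eval M v t2
  | FMark _ i t => fun v => mmark M i (term_eval M v t)
  | FNot _ phi1 => fun v => ~ sat M phi1 v
  | FAnd _ phi1 phi2 => fun v => sat M phi1 v /\ sat M phi2 v
  | FEx _ phi1 => fun v => exists x : T, sat M phi1 [tuple of x :: v]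
  end.

Definition models (c : nat) (T : Type) (M : mapping c T)
    (theta : formula c 0) : Prop :=
  sat M theta [tuple].

(* As usual for first-order structures, the domain is nonempty. *)
Record finite_mapping (c : nat) := FiniteMapping {
  fm_dom : finType;
  fm_map : mapping c fm_dom;
  fm_dom_gt0 : (0 < #|fm_dom|)%N
}.

Definition finite_pairing (R : realType) (c p : nat) (phi : formula c p)
    (F : finite_mapping c) : R :=
  #|[pred v : p.-tuple (fm_dom F) | `[< sat (fm_map F) phi v >]]|%:R
    / #|fm_dom F|%:R ^+ p.

Definition FO_convergent (R : realType) (c : nat)
    (F : nat -> finite_mapping c) : Prop :=
  forall (p : nat) (phi : formula c p),
    cvg ((fun n => finite_pairing R phi (F n)) @ \oo).

Definition polish (R : realType) (X : metricType R) : Prop :=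
  (forall u : nat -> X, cauchy (u @ \oo) -> exists l : X, u @ \oo --> l) /\
  (exists2 D : set X, countable D & dense D).

(* The sigma-algebra of T is the Borel sigma-algebra of some Polish space X,
   transported along a bijection g (the type T carries no topology of its own). *)
Definition standard_borel (R : realType) (d : measure_display)
    (T : measurableType d) : Prop :=
  exists (X : metricType R) (g : T -> X),
    [/\ polish X, bijective g &
        forall A : set T, measurable A <->
          exists2 B : set X, <<s [set U : set X | open U] >> B & A = g @^-1` B].

Definition modeling_mapping (R : realType) (d : measure_display)
    (T : measurableType d) (c : nat) (M : mapping c T) : Prop :=
  standard_borel R T /\
  forall (p : nat) (phi : formula c p),
    measurable [set v : p.-tuple T | sat M phi v].

Section product_power.
Context (R : realType) (d : measure_display) (T : measurableType d).

Definition cons_pair (p : nat) (z : T * p.-tuple T) : p.+1.-tuple T :=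
  [tuple of z.1 :: z.2].

Lemma measurable_cons_pair (p : nat) :
  measurable_fun [set: T * p.-tuple T] (@cons_pair p).
Proof. exact: measurable_cons measurable_fst measurable_snd. Qed.

HB.instance Definition _ (p : nat) :=
  isMeasurableFun.Build _ _ _ _ (@cons_pair p) (@measurable_cons_pair p).

(* The p-fold product measure on p.-tuple T, through the identification of
   T * p.-tuple T with p.+1.-tuple T. *)
Fixpoint product_power (nu : probability T R) (p : nat) :
    probability (p.-tuple T) R :=
  match p with
  | 0 => \d_([tuple] : 0.-tuple T)
  | p'.+1 => distribution (nu \x product_power nu p')%E (@cons_pair p')
  end.

End product_power.

Definition modeling_pairing (R : realType) (d : measure_display)
    (T : measurableType d) (nu : probability T R) (c : nat) (M : mapping c T)
    (p : nat) (phi : formula c p) : R :=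
  fine (product_power nu p [set v : p.-tuple T | sat M phi v]).

Definition FO_limit (R : realType) (c : nat) (F : nat -> finite_mapping c)
    (d : measure_display) (T : measurableType d) (nu : probability T R)
    (M : mapping c T) : Prop :=
  forall (p : nat) (phi : formula c p),
    (fun n => finite_pairing R phi (F n)) @ \oo --> modeling_pairing nu M phi.

Definition atomless (R : realType) (d : measure_display)
    (T : measurableType d) (nu : probability T R) : Prop :=
  forall v : T, nu [set v] = 0%E.

Definition finite_model_property (c : nat) (T : Type) (M : mapping c T) : Prop :=
  forall theta : formula c 0, models M theta ->
    exists F : finite_mapping c, models (fm_map F) theta.

Definition infinite_fibers (c : nat) (T : Type) (M : mapping c T) : set T :=
  [set x | infinite_set (mfn M @^-1` [set x])].

Definition finitary_mass_transport (R : realType) (d : measure_display)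
    (T : measurableType d) (nu : probability T R) (c : nat) (M : mapping c T) :
    Prop :=
  nu (infinite_fibers M) = 0%E /\
  forall A B : set T, measurable A -> measurable B ->
    A `<=` ~` infinite_fibers M -> B `<=` ~` infinite_fibers M ->
    nu (A `&` mfn M @^-1` B) =
      (\int[nu]_(y in B) counting (mfn M @^-1` [set y] `&` A))%E.

(* Main.v *)
Require Import Defs.
From HB Require Import structures.
From mathcomp Require Import all_boot all_order all_algebra.
From mathcomp Require Import all_classical all_reals all_analysis.
From mathcomp Require Import measurable_realfun zify.

Set Implicit Arguments.
Unset Strict Implicit.
Unset Printing Implicit Defensive.

Import Order.TTheory GRing.Theory Num.Theory.
Import numFieldNormedType.Exports.

Local Open Scope classical_set_scope.
Local Open Scope ring_scope.

(* Along an ultrafilter U, the F_n have an ultraproduct, which is saturated, and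
   counting measures yield a Loeb measure on it.  The type of a point of the
   ultraproduct records its membership in countably many internal sets, closed
   under Boolean operations, f-images, f-preimages, picking the s-th element,
   and selecting the j-th sibling.  A point of the limit L is such a type
   together with independent uniform bits attached to its component and to its
   iterates, which are erased when the type determines the point among its
   siblings (or in a named component).  L is a closed subset of a Cantor space,
   and f acts on it by a shift.

   Saturation gives a back-and-forth between tuples of L and of the ultraproduct
   with equal types and equal coincidence patterns f^i(x_a) = f^j(x_b).  Hence
   both satisfy the same formulas, and by compactness definable sets are
   finite Boolean combinations of Borel conditions.  The measure on L is the law
   of the point built from a Loeb-random point and random bits; independent
   samples almost surely have the same coincidence pattern on both sides, so
   Stone pairings agree.  Finally f maps the points that are j-th siblings
   bijectively, and measure-preservingly, onto the points with more than j
   preimages; summing over j gives the mass transport principle. *)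

(** * Ultrafilters, saturation and Loeb measures *)

(** Two obstacles shape the construction. The Loeb space is too large to be standard Borel, so [L]
    can keep only countably many bits of a point; yet types alone would merge infinitely many
    indistinguishable vertices into one, and equality, hence satisfaction, would be lost. The random
    bits restore the missing multiplicity. They must vanish where the ultraproduct leaves a single
    choice, or [L] would contain spurious copies, and survive where it leaves infinitely many; the
    codes are closed under enough operations to tell the two cases apart. Since bits are attached to
    the iterates and not only to the point, an image inherits its bits and [f] needs no fresh
    randomness.

    Moreover Stone pairings control only definable sets, whereas mass transport concerns all
    measurable ones, so it has to be built in: an arbitrary order on each finite domain ranks
    siblings inside the codes, and the finite map, bits included, is injective on each rank. *)

Section ultra.
Context {U : set_system nat} {UU : UltraFilter U}.

Local Notation ae P := (U P).

Lemma ultraN (P : nat -> Prop) : ae (fun n => ~ P n) <-> ~ ae P.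
Proof.
split=> [nP hP|nP].
  apply: (@filter_not_empty _ U _).
  by apply: filterS (filterI nP hP) => n [].
by have [] := in_ultra_setVsetC P UU.
Qed.

Lemma ultraI (P Q : nat -> Prop) : ae (fun n => P n /\ Q n) <-> ae P /\ ae Q.
Proof.
split=> [H|[hP hQ]]; last exact: filterI.
by split; apply: filterS H => n [].
Qed.

Lemma ultraU (P Q : nat -> Prop) : ae (fun n => P n \/ Q n) <-> ae P \/ ae Q.
Proof.
split=> [H|[] H]; last 2 first.
- by apply: filterS H => n; left.
- by apply: filterS H => n; right.
have [hP|nP] := pselect (ae P); first by left.
by have hP := (ultraN P).2 nP; right; apply: filterS (filterI H hP) => n [[]].
Qed.

Lemma ultra_const (P : Prop) : ae (fun=> P) <-> P.
Proof.
split=> [H|p]; last exact: filterE.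
by apply: contrapT => nP; apply: (ultraN (fun=> P)).1 H; exact: filterE.
Qed.

(** An ultrafilter chooses among finitely many cases. This turns an index that is bounded but varies
    with [n] into a constant one, which a code can mention. *)
Lemma ultra_exists_lt (P : nat -> nat -> Prop) k :
  ae (fun n => exists2 j, (j < k)%N & P j n) -> exists2 j, (j < k)%N & ae (P j).
Proof.
elim: k => [|k IH] H.
  by have /ultra_const[] : ae (fun=> False) by apply: filterS H => n [].
have /ultraU[/IH[j jk Pj]|Pk] :
    ae (fun n => (exists2 j, (j < k)%N & P j n) \/ P k n).
- apply: filterS H => n [j]; rewrite ltnS leq_eqVlt => /orP[/eqP->|jk] Pj.
    by right.
  by left; exists j.
- by exists j => //; exact: ltnW.
- by exists k.
Qed.

Lemma ultra_all (T : eqType) (s : seq T) (P : T -> nat -> Prop) :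
  (forall x, x \in s -> ae (P x)) ->
  ae (fun n => forall x, x \in s -> P x n).
Proof.
elim: s => [|y s IH] H; first exact: filterE.
have Hs : ae (fun n => forall x, x \in s -> P x n).
  by apply: IH => x xs; apply: H; rewrite inE xs orbT.
have Hy : ae (P y) by apply: H; rewrite mem_head.
apply: filterS (filterI Hs Hy) => n [Ps Py] x.
by rewrite inE => /predU1P[->|/Ps].
Qed.

Section dependent_choice.
Context {G : nat -> Type} (g0 : forall n, G n).

Lemma ultra_exists (P : forall n, G n -> Prop) :
  ae (fun n => exists x, P n x) <-> exists x : forall n, G n, ae (fun n => P n (x n)).
Proof.
split=> [H|[x H]]; last by apply: filterS H => n Px; exists (x n).
have ex n : exists x, (exists y, P n y) -> P n x.
  by have [[y Py]|nP] := pselect (exists y, P n y); [exists y|exists (g0 n)].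
exists (fun n => sval (cid (ex n))).
by apply: filterS H => n; exact: svalP (cid (ex n)).
Qed.

End dependent_choice.
End ultra.

Section saturation.
Context {U : set_system nat} {UU : UltraFilter U}.
Hypothesis Uoo : \oo `<=` U.
Local Notation ae P := (U P).
Context {G : nat -> Type} (g0 : forall n, G n).

Lemma ultra_ge k : ae (fun n => (k <= n)%N).
Proof. by apply: Uoo; exists k. Qed.

(** Diagonal argument: coordinate [n] meets [D 0], ..., [D k] for the largest possible [k <= n], and
    each fixed [k] is below [n] on a set of [U] because [U] refines [\oo]. *)
Lemma saturation_nat (D : nat -> forall n, set (G n)) :
  (forall k, ae (fun n => exists x, forall j, (j <= k)%N -> D j n x)) ->
  exists x : forall n, G n, forall k, ae (fun n => D k n (x n)).
Proof.
move=> H.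
pose good n k := exists x, forall j, (j <= k)%N -> D j n x.
pose P n x := forall k, (k <= n)%N -> good n k -> forall j, (j <= k)%N -> D j n x.
have ex n : exists x, P n x.
  suff H1 m : exists x, forall k, (k <= m)%N -> good n k ->
    forall j, (j <= k)%N -> D j n x by have [x Hx] := H1 n; exists x.
  elim: m => [|m [x IH]].
    have [[x Hx]|ng] := pselect (good n 0); last first.
      by exists (g0 n) => k; rewrite leqn0 => /eqP->.
    by exists x => k; rewrite leqn0 => /eqP->.
  have [[y Hy]|ng] := pselect (good n m.+1).
    by exists y => k km _ j jk; apply: Hy; exact: leq_trans km.
  exists x => k; rewrite leq_eqVlt => /orP[/eqP->//|].
  by rewrite ltnS; exact: IH.
exists (fun n => sval (cid (ex n))) => k.
apply: filterS (filterI (ultra_ge k) (H k)) => n [kn gk].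
have Px : P n (sval (cid (ex n))) by exact: svalP.
exact: Px kn gk _ (leqnn k).
Qed.

Lemma saturation (I : countType) (D : I -> forall n, set (G n)) :
  (forall s : seq I, ae (fun n => exists x, forall i, i \in s -> D i n x)) ->
  exists x : forall n, G n, forall i, ae (fun n => D i n (x n)).
Proof.
move=> H.
pose E k n x := if unpickle k is Some i then D i n x else True.
have [|x Hx] := @saturation_nat E.
  move=> k; apply: filterS (H (pmap unpickle (iota 0 k.+1))) => n [x Hx].
  exists x => j jk; rewrite /E; case ji : (unpickle j) => [i|//].
  apply: Hx; rewrite mem_pmap; apply/mapP; exists j => //.
  by rewrite mem_iota.
exists x => i; move: (Hx (pickle i)); rewrite /E.
by under eq_fun do rewrite pickleK.
Qed.

End saturation.

Section ultralimit.
Context (R : realType) {U : set_system nat} {UU : UltraFilter U}.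

Definition ulim (a : nat -> R) : R := lim (a @ U).

Lemma cvg_ulim (a : nat -> R) :
  (forall n, 0 <= a n <= 1) -> a @ U --> ulim a.
Proof.
move=> a01; suff : cvg (a @ U) by [].
have : compact `[0%R, 1%R : R]%classic by exact: segment_compact.
rewrite compact_ultra.
have aU : UltraFilter (a @ U).
  split; first exact: fmap_proper_filter.
  move=> H HP aH; apply/seteqP; split=> // A HA.
  have [//|nA] := in_ultra_setVsetC (a @^-1` A) UU.
  exfalso; apply: (@filter_not_empty _ H HP).
  by apply: filterS (filterI (aH (~` A) nA) HA) => x [].
case/(_ _ aU).
  change (U (fun n => `[0%R, 1%R : R]%classic (a n))).
  by apply: filterE => n; rewrite /= in_itv /= a01.
by move=> l [_ al]; apply/cvg_ex; exists l.
Qed.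

Lemma ulimE (a : nat -> R) l : a @ U --> l -> ulim a = l.
Proof. exact: cvg_lim. Qed.

End ultralimit.

(* The pointed type structure needs a witness of nonemptiness, hence [g0]. *)
Definition uprod (U : set_system nat) (G : nat -> finType)
  (g0 : forall n, G n) : Type := forall n, G n.

Section internal.
Context (U : set_system nat) (G : nat -> finType) (g0 : forall n, G n).

HB.instance Definition _ := gen_eqMixin (uprod U g0).
HB.instance Definition _ := gen_choiceMixin (uprod U g0).
HB.instance Definition _ := isPointed.Build (uprod U g0) g0.

Definition internal (D : forall n, {set G n}) : set (uprod U g0) :=
  [set x | U (fun n => x n \in D n)].

End internal.

Section internal_algebra.
Context {U : set_system nat} {UU : UltraFilter U}.
Context {G : nat -> finType} (g0 : forall n, G n).
Local Notation internal := (@internal U G g0).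

Lemma internalC D : ~` internal D = internal (fun n => ~: D n).
Proof.
apply/seteqP; split=> x /=.
  move=> /((ultraN (fun n => x n \in D n)).2).
  by apply: filterS => n /negP; rewrite inE.
move=> H; apply: (ultraN (fun n => x n \in D n)).1.
by apply: filterS H => n; rewrite inE => /negP.
Qed.

Lemma internalI D E : internal D `&` internal E = internal (fun n => D n :&: E n).
Proof.
apply/seteqP; split=> x /=.
  by move=> [xD xE]; apply: filterS (filterI xD xE) => n [/= a b]; rewrite inE a b.
by move=> H; split; apply: filterS H => n; rewrite inE => /andP[].
Qed.

Lemma internalU D E : internal D `|` internal E = internal (fun n => D n :|: E n).
Proof.
apply/seteqP; split=> x /=.
  move=> /((ultraU (fun n => x n \in D n) (fun n => x n \in E n)).2).
  by apply: filterS => n H; rewrite inE; apply/orP.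
move=> H; apply: (ultraU (fun n => x n \in D n) (fun n => x n \in E n)).1.
by apply: filterS H => n; rewrite inE => /orP.
Qed.

Lemma internal0 : internal (fun=> finset.set0) = set0.
Proof.
apply/seteqP; split=> x //= H.
by apply: (@filter_not_empty _ U _); apply: filterS H => n; rewrite inE.
Qed.

Lemma internalT : internal (fun n => [set: G n]%SET) = setT.
Proof. by apply/seteqP; split=> x //= _; apply: filterE => n; rewrite inE. Qed.

(** Otherwise a point chosen in [D n :\: E n] on almost every coordinate would separate the two
    internal sets. Hence the density does not depend on the representative. *)
Lemma internal_sub D E :
  internal D `<=` internal E -> U (fun n => D n \subset E n).
Proof.
move=> DE; apply: contrapT => /((ultraN (fun n => D n \subset E n)).2) H.
have [x Hx] : exists x : forall n, G n, U (fun n => x n \in D n :\: E n).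
  apply: (ultra_exists g0 (fun n x => x \in D n :\: E n)).1.
  apply: filterS H => n /negP/subsetPn[x xD xE].
  by exists x; rewrite inE xE.
have : internal E x by apply: DE; apply: filterS Hx => n; rewrite inE => /andP[].
have : internal (fun n => ~: E n) x.
  by apply: filterS Hx => n; rewrite !inE => /andP[].
by rewrite -internalC.
Qed.

Definition internals : set (set (uprod U g0)) := range internal.

Lemma internals0 : internals set0.
Proof. by exists (fun=> finset.set0) => //; exact: internal0. Qed.

Lemma internalsU : setU_closed internals.
Proof. by move=> _ _ [D _ <-] [E _ <-]; rewrite internalU; eexists. Qed.

Lemma internalsI : setI_closed internals.
Proof. by move=> _ _ [D _ <-] [E _ <-]; rewrite internalI; eexists. Qed.

Lemma internalsC : setC_closed internals.
Proof. by move=> _ [D _ <-]; rewrite internalC; eexists. Qed.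

Hypothesis Uoo : \oo `<=` U.

(** Compactness from saturation: if every finite stage leaves a point of [E] uncovered, a single
    point of [E] escapes all the [D k]. *)
Lemma internal_bigcup (D : nat -> forall n, {set G n}) E :
  internal E `<=` \bigcup_k internal (D k) ->
  exists N, internal E `<=` \bigcup_(k < N) internal (D k).
Proof.
move=> EsubD; apply: contrapT => /forallNP H.
have [|x Hx] := @saturation_nat U _ Uoo G g0
    (fun k n => [set x | x \in E n /\ x \notin D k n]).
  move=> k; have /existsNP[x /not_implyP[xE xD]] := H k.+1.
  have xDk j : (j <= k)%N -> U (fun n => x n \notin D j n).
    move=> jk; have : (~` internal (D j)) x by move=> xDj; apply: xD; exists j.
    by rewrite internalC; apply: filterS => n; rewrite inE.
  have Hall : U (fun n => forall j, j \in iota 0 k.+1 -> x n \notin D j n).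
    by apply: ultra_all => j; rewrite mem_iota /= add0n ltnS => /xDk.
  apply: filterS (filterI xE Hall) => n [xEn xDn].
  by exists (x n) => j jk; split=> //; apply: xDn; rewrite mem_iota.
have xE : internal E x by apply: filterS (Hx 0) => n [].
have [k _ xD] := EsubD x xE.
have : internal (fun n => ~: D k n) x by apply: filterS (Hx k) => n []; rewrite inE.
by rewrite -internalC.
Qed.

End internal_algebra.

(** * Limit densities and the Loeb measure *)

Section density.
Context (R : realType) {U : set_system nat} {UU : UltraFilter U}.
Context {G : nat -> finType} (g0 : forall n, G n).

Implicit Types D E : forall n, {set G n}.

Definition ratio (D : forall n, {set G n}) n : R := #|D n|%:R / #|G n|%:R.

Definition density (D : forall n, {set G n}) : R := @ulim R U (ratio D).

Lemma card_gt0_wit n : (0 < #|G n|)%N.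
Proof. by apply/card_gt0P; exists (g0 n). Qed.

Lemma ratio01 D n : 0 <= ratio D n <= 1.
Proof.
have G0 : (0 : R) < #|G n|%:R by rewrite ltr0n card_gt0_wit.
rewrite /ratio divr_ge0//= ler_pdivrMr// mul1r ler_nat.
exact: max_card.
Qed.

Lemma cvg_density D : ratio D @ U --> density D.
Proof. by apply: cvg_ulim; exact: ratio01. Qed.

Lemma density_near D E : U (fun n => ratio D n = ratio E n) -> density D = density E.
Proof.
move=> DE; apply: ulimE; apply: (cvg_trans _ (@cvg_density E)).
by apply: near_eq_cvg; apply: filterS DE => n ->.
Qed.

Lemma density_le D (r : R) : U (fun n => ratio D n <= r) -> density D <= r.
Proof.
move=> DE; have := @ler_cvg_to _ U _ _ _ _ _ _ (@cvg_density D) (cvg_cst r).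
exact.
Qed.

Lemma density_ge0 D : 0 <= density D.
Proof.
have := @ler_cvg_to _ U _ _ _ _ _ _ (cvg_cst 0) (@cvg_density D).
by apply; apply: filterE => n; case/andP: (ratio01 D n).
Qed.

Lemma densityT : density (fun n => [set: G n]%SET) = 1.
Proof.
apply: ulimE; rewrite (_ : ratio _ = cst 1); first exact: cvg_cst.
apply/funext => n; rewrite /ratio cardsT divff//.
by rewrite pnatr_eq0 -lt0n card_gt0_wit.
Qed.

Lemma densityU D E : U (fun n => D n :&: E n = finset.set0) ->
  density (fun n => D n :|: E n) = density D + density E.
Proof.
move=> DE; apply: ulimE.
apply: (cvg_trans _ (cvgD (@cvg_density D) (@cvg_density E))).
apply: near_eq_cvg; apply: filterS DE => n dn.
by rewrite /ratio /= fctE -mulrDl -natrD -cardsUI dn cards0 addn0.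
Qed.

Lemma density0 : density (fun n => finset.set0) = 0.
Proof.
apply: ulimE; rewrite (_ : ratio _ = cst 0); first exact: cvg_cst.
by apply/funext => n; rewrite /ratio cards0 mul0r.
Qed.

End density.

Definition loeb_algebra (U : set_system nat) (G : nat -> finType)
  (g0 : forall n, G n) : Type := uprod U g0.

Section loeb.
Context (R : realType) {U : set_system nat} {UU : UltraFilter U}.
Hypothesis Uoo : \oo `<=` U.
Context {G : nat -> finType} (g0 : forall n, G n).
Local Notation T := (loeb_algebra U g0).

HB.instance Definition _ := Pointed.on T.
HB.instance Definition _ := isAlgebraOfSets.Build default_measure_display T
  (@internals0 U UU G g0) (@internalsU U UU G g0) (@internalsC U UU G g0).

Local Open Scope ereal_scope.

Definition content_set (A : set T) : forall n, {set G n} :=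
  if pselect (exists D, @internal U G g0 D = A) is left H then sval (cid H)
  else fun=> finset.set0.

Definition loeb_content (A : set T) : \bar R :=
  (@density R U G (content_set A))%:E.

Lemma loeb_contentE D :
  loeb_content (@internal U G g0 D) = (@density R U G D)%:E.
Proof.
rewrite /loeb_content /content_set; case: pselect => [H|[]]; last by exists D.
case: (cid H) => E /= ED; congr (_%:E); apply: density_near => //.
have /(internal_sub (g0 := g0)) H1 : @internal U G g0 E `<=` @internal U G g0 D by rewrite ED.
have /(internal_sub (g0 := g0)) H2 : @internal U G g0 D `<=` @internal U G g0 E by rewrite ED.
apply: filterS (filterI H1 H2) => n [a b].
rewrite /ratio; suff -> : D n = E n by [].
by apply/eqP; rewrite finset.eqEsubset a b.
Qed.

Lemma loeb_content0 : loeb_content set0 = 0.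
Proof. by rewrite -(internal0 g0) loeb_contentE density0. Qed.

Lemma loeb_content_ge0 A : 0 <= loeb_content A.
Proof. by rewrite lee_fin density_ge0. Qed.

Lemma loeb_contentU (A B : set T) : measurable A -> measurable B ->
  A `&` B = set0 -> loeb_content (A `|` B) = loeb_content A + loeb_content B.
Proof.
move=> [D _ <-] [E _ <-] DE; rewrite internalU !loeb_contentE densityU//.
have /(internal_sub (g0 := g0)) H :
    @internal U G g0 (fun n => D n :&: E n) `<=` @internal U G g0 (fun=> finset.set0).
  by rewrite -internalI DE internal0.
by apply: filterS H => n; rewrite finset.subset0 => /eqP.
Qed.

Lemma loeb_content_additive (F : nat -> set T) N :
  (forall k, measurable (F k)) -> trivIset setT F ->
  measurable (\bigcup_(k < N) F k) /\
  loeb_content (\bigcup_(k < N) F k) = \sum_(0 <= k < N) loeb_content (F k).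
Proof.
move=> mF tF; elim: N => [|N [mN IH]].
  by rewrite bigcup_mkord !big_ord0 big_nil; split; [exact: internals0|exact: loeb_content0].
rewrite big_nat_recr//= -IH bigcup_mkord big_ord_recr/= -bigcup_mkord.
split; first exact: measurableU.
apply: loeb_contentU => //; apply/seteqP; split=> // x [[k /= kN Fk] FN].
have kN' : k = N by apply: tF => //; exists x.
by rewrite kN' ltnn in kN.
Qed.

(** By compactness, disjoint internal sets with an internal union are empty from some index on, so
    the series is a finite sum. *)
Lemma loeb_content_sigma_additive : semi_sigma_additive loeb_content.
Proof.
move=> F mF tF mUF.
have [D HD] : exists D : nat -> forall n, {set G n},
    forall k, F k = @internal U G g0 (D k).
  have H k : exists D, @internal U G g0 D = F k by have [D _ <-] := mF k; exists D.
  by exists (fun k => sval (cid (H k))) => k; rewrite (svalP (cid (H k))).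
have [E _ HE] := mUF.
have [N HN] : exists N, \bigcup_k F k `<=` \bigcup_(k < N) F k.
  have [|N HN] := @internal_bigcup U UU G g0 Uoo D E.
    by move=> x; rewrite HE => -[k _]; rewrite HD => xk; exists k.
  by exists N => x; rewrite -HE => /HN[k kN]; rewrite -HD => xk; exists k.
apply: cvg_near_cst; exists N => // m /= Nm.
rewrite -(loeb_content_additive m mF tF).2; congr loeb_content.
apply/seteqP; split=> x; first by move=> [k _ xk]; exists k.
by move=> /HN[k /= kN xk]; exists k => //=; exact: leq_trans Nm.
Qed.

HB.instance Definition _ := isMeasure.Build _ T R loeb_content
  loeb_content0 loeb_content_ge0 loeb_content_sigma_additive.

(** Without completion, so that finite measures on it are determined by the internal sets. *)
Definition loeb_type : Type := g_sigma_algebraType (@measurable _ T).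
HB.instance Definition _ := Measurable.on loeb_type.

Definition loeb : set loeb_type -> \bar R :=
  measure_extension (loeb_content : measure T R).
HB.instance Definition _ := Measure.on loeb.

Lemma loebE D : loeb (@internal U G g0 D) = (@density R U G D)%:E.
Proof.
rewrite /loeb /measure_extension measurable_mu_extE; first exact: loeb_contentE.
by exists D.
Qed.

Lemma loebT : loeb [set: loeb_type] = 1.
Proof. by have := loebE (fun n => [set: G n]%SET); rewrite internalT densityT. Qed.

HB.instance Definition _ := Measure_isProbability.Build _ _ _ loeb loebT.

Lemma measurable_internal D : measurable (@internal U G g0 D : set loeb_type).
Proof. by apply: sub_sigma_algebra; exists D. Qed.

End loeb.

(** * Codes of internal sets *)

Section position.
Context {T : finType}.
Implicit Types (E : {set T}) (x y : T).

(** An arbitrary order makes this a bijection from [E] onto the integers below [#|E|]; it serves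
    both to name points and to rank siblings. *)
Definition position E x := #|[set y in E | (enum_rank y < enum_rank x)%N]|.

Lemma position_lt E x : x \in E -> (position E x < #|E|)%N.
Proof.
move=> xE; apply: proper_card; apply/properP; split.
  by apply/fintype.subsetP => y; rewrite inE => /andP[].
by exists x => //; rewrite inE ltnn andbF.
Qed.

Lemma position_inj E : {in E &, injective (position E)}.
Proof.
have lt x y : x \in E -> (enum_rank x < enum_rank y)%N ->
    (position E x < position E y)%N.
  move=> xE xy; apply: proper_card; apply/properP; split.
    apply/fintype.subsetP => z; rewrite !inE => /andP[-> zx]; exact: ltn_trans xy.
  by exists x; rewrite inE xE ?ltnn.
move=> x y xE yE exy; apply: enum_rank_inj; apply: val_inj => /=.
case: (ltngtP (enum_rank x) (enum_rank y)) => //.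
  by move/(lt _ _ xE); rewrite exy ltnn.
by move/(lt _ _ yE); rewrite exy ltnn.
Qed.

Lemma position_surj E j : (j < #|E|)%N -> exists2 x, x \in E & position E x = j.
Proof.
move=> jE; pose s := [seq position E x | x <- enum E].
have us : uniq s.
  rewrite map_inj_in_uniq ?enum_uniq// => x y; rewrite !mem_enum.
  exact: position_inj.
have ss : {subset s <= iota 0 #|E|}.
  move=> y /mapP[x]; rewrite mem_enum => xE ->.
  by rewrite mem_iota /= position_lt.
have [|_ es] := uniq_min_size us ss; first by rewrite size_map size_iota cardE.
have : j \in s by rewrite es mem_iota.
by case/mapP => x; rewrite mem_enum => xE ->; exists x.
Qed.

End position.

Section run_length.
Context {T : Type} (h : T -> nat) (B : nat) (hB : forall x, (h x <= B)%N).
Variable g : T -> T.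

Lemma run_ends x : exists i, ~~ (h (iter i g x) < h (iter i.+1 g x))%N.
Proof.
apply: contrapT => /forallNP H.
have Hi i : (i <= h (iter i g x))%N.
  elim: i => // i IH; apply: leq_ltn_trans IH _.
  by have /negP := H i; rewrite negbK.
by have := leq_trans (Hi B.+1) (hB _); rewrite ltnn.
Qed.

(** The number of consecutive increases of [h] from [x] on. Its parity flips across an increase, so
    a height and its reverse together give two sets separating [x] from [g x] whenever their heights
    differ. *)
Definition run_length x := ex_minn (run_ends x).

Lemma run_lengthS x : (h x < h (g x))%N -> run_length x = (run_length (g x)).+1.
Proof.
move=> hx; rewrite /run_length.
have PS i : (h (iter i g (g x)) < h (iter i.+1 g (g x)))%N =
    (h (iter i.+1 g x) < h (iter i.+2 g x))%N by rewrite -!iterSr.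
case: ex_minnP => -[|m] Hm minm; first by rewrite /= hx in Hm.
case: ex_minnP => j Hj minj; congr S; apply/eqP; rewrite eqn_leq.
by rewrite -ltnS minm -?PS//= minj // PS.
Qed.

End run_length.

Section code.
Context (c : nat).

(* Codes of the internal sets whose membership makes up the type of a point.
   [CHeavy i k] collects the points whose i-th preimage has density at least
   1/k, so that two independent random points can only merge at points that are
   named by a code [CNth s D]; [CAsc k] and [CDesc k] separate x from f^k(x)
   whenever they differ; [CRank j D] holds at most one point of each fibre. *)
Inductive code : Type :=
| CMark of 'I_c
| CHeavy of nat & nat
| CLoop of nat
| CAsc of nat
| CDesc of nat
| CNot of code
| CAnd of code & code
| CPre of code
| CIm of code
| CNth of nat & code
| CRank of nat & code.

Fixpoint code_enc (D : code) : GenTree.tree ('I_c + nat) :=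
  match D with
  | CMark i => GenTree.Leaf (inl i)
  | CHeavy i k => GenTree.Node 0 [:: GenTree.Leaf (inr i); GenTree.Leaf (inr k)]
  | CLoop k => GenTree.Node 1 [:: GenTree.Leaf (inr k)]
  | CAsc k => GenTree.Node 2 [:: GenTree.Leaf (inr k)]
  | CDesc k => GenTree.Node 3 [:: GenTree.Leaf (inr k)]
  | CNot D => GenTree.Node 4 [:: code_enc D]
  | CAnd D E => GenTree.Node 5 [:: code_enc D; code_enc E]
  | CPre D => GenTree.Node 6 [:: code_enc D]
  | CIm D => GenTree.Node 7 [:: code_enc D]
  | CNth s D => GenTree.Node 8 [:: GenTree.Leaf (inr s); code_enc D]
  | CRank s D => GenTree.Node 9 [:: GenTree.Leaf (inr s); code_enc D]
  end.

Fixpoint code_dec (t : GenTree.tree ('I_c + nat)) : option code :=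
  match t with
  | GenTree.Leaf (inl i) => Some (CMark i)
  | GenTree.Node 0 [:: GenTree.Leaf (inr i); GenTree.Leaf (inr k)] =>
      Some (CHeavy i k)
  | GenTree.Node 1 [:: GenTree.Leaf (inr k)] => Some (CLoop k)
  | GenTree.Node 2 [:: GenTree.Leaf (inr k)] => Some (CAsc k)
  | GenTree.Node 3 [:: GenTree.Leaf (inr k)] => Some (CDesc k)
  | GenTree.Node 4 [:: t] => omap CNot (code_dec t)
  | GenTree.Node 5 [:: t; u] =>
      obind (fun D => omap (CAnd D) (code_dec u)) (code_dec t)
  | GenTree.Node 6 [:: t] => omap CPre (code_dec t)
  | GenTree.Node 7 [:: t] => omap CIm (code_dec t)
  | GenTree.Node 8 [:: GenTree.Leaf (inr s); t] => omap (CNth s) (code_dec t)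
  | GenTree.Node 9 [:: GenTree.Leaf (inr s); t] => omap (CRank s) (code_dec t)
  | _ => None
  end.

Lemma code_encK : pcancel code_enc code_dec.
Proof.
by elim=> //= [D ->|D -> E ->|D ->|D ->|s D ->|s D ->].
Qed.

HB.instance Definition _ := Countable.copy code (pcan_type code_encK).

(** True everywhere: the zeroth iterate is the point itself. *)
Definition CTrue := CLoop 0.

(** As a single code, a finite piece of a type can be placed under [CIm] and [CRank]. *)
Fixpoint CConj (q : code -> bool) (s : seq code) : code :=
  if s is D :: s' then CAnd (if q D then D else CNot D) (CConj q s') else CTrue.

Definition shift_type (q : code -> bool) : code -> bool := fun D => q (CPre D).

End code.
Arguments CHeavy {c}.
Arguments CLoop {c}.
Arguments CAsc {c}.
Arguments CDesc {c}.
Arguments CTrue {c}.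

Section denotation.
Context (c : nat) (T : finType) (M : mapping c T).
Local Notation f := (mfn M).

Lemma enum_rank_le (x : T) : (enum_rank x <= #|T|)%N.
Proof. exact/ltnW/ltn_ord. Qed.

Lemma enum_rank_sub_le (x : T) : (#|T| - enum_rank x <= #|T|)%N.
Proof. exact: leq_subr. Qed.

Fixpoint den (D : code c) : {set T} :=
  match D with
  | CMark i => [set x | `[< mmark M i x >]]
  | CHeavy i k => [set x | (#|T| <= k * #|[set y | iter i f y == x]|)%N]
  | CLoop k => [set x | iter k f x == x]
  | CAsc k => [set x | odd (run_length enum_rank_le (iter k f) x)]
  | CDesc k => [set x | odd (run_length enum_rank_sub_le (iter k f) x)]
  | CNot D => ~: den D
  | CAnd D E => den D :&: den E
  | CPre D => f @^-1: den D
  | CIm D => f @: den D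
  | CNth s D => [set x in den D | position (den D) x == s]
  | CRank j D =>
      [set x in den D | position [set y in den D | f y == f x] x == j]
  end%SET.

Lemma denT x : x \in den CTrue.
Proof. by rewrite inE. Qed.

(** Distinct vertices have distinct ranks in the enumeration; going up flips the parity of the
    ascending run, going down that of the descending run. *)
Lemma den_color k x : iter k f x != x ->
  (x \in den (CAsc k)) != (iter k f x \in den (CAsc k)) \/
  (x \in den (CDesc k)) != (iter k f x \in den (CDesc k)).
Proof.
move=> kx; rewrite !inE.
have ne : enum_rank x != enum_rank (iter k f x) :> nat.
  by apply: contra_neq kx => /val_inj/enum_rank_inj.
have [lt|gt|eq] := ltngtP (enum_rank x) (enum_rank (iter k f x)).
- by left; rewrite (run_lengthS enum_rank_le (g := iter k f) lt) /=; case: odd.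
- right; have lt : (#|T| - enum_rank x < #|T| - enum_rank (iter k f x))%N.
    by rewrite ltn_sub2l.
  by rewrite (run_lengthS enum_rank_sub_le (g := iter k f) lt) /=; case: odd.
- by rewrite eq eqxx in ne.
Qed.

Lemma den_CNth_eq s D x y : x \in den (CNth s D) -> y \in den (CNth s D) -> x = y.
Proof.
rewrite !inE => /andP[xD /eqP xs] /andP[yD /eqP ys].
by apply: (@position_inj _ (den D)) => //; rewrite xs ys.
Qed.

Lemma den_CRank_eq j D x y : x \in den (CRank j D) -> y \in den (CRank j D) ->
  f x = f y -> x = y.
Proof.
rewrite !inE => /andP[xD /eqP xs] /andP[yD /eqP ys] fxy.
apply: (@position_inj _ [set z in den D | f z == f x]).
- by rewrite inE xD eqxx.
- by rewrite inE yD fxy eqxx.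
- by rewrite xs fxy ys.
Qed.

Lemma den_unique_CRank D x : x \in den D ->
  (forall y, y \in den D -> f y = f x -> y = x) -> x \in den (CRank 0 D).
Proof.
move=> xD Hx; rewrite inE xD /= -leqn0 -ltnS.
have <- : #|[set y in den D | f y == f x]%SET| = 1%N.
  rewrite (_ : [set y in _ | _]%SET = [set x]%SET) ?cards1//.
  apply/setP => y; rewrite !inE; apply/andP/eqP => [[yD /eqP]|->//].
  exact: Hx.
by apply: position_lt; rewrite inE xD eqxx.
Qed.

(** Positions fill an initial segment of the integers, so a [j]-th child exists exactly when there
    are more than [j] children. Types thus see the sizes of fibres. *)
Lemma den_CIm_CRank j D u :
  (u \in den (CIm (CRank j D))) = (j < #|[set y in den D | f y == u]|)%N.
Proof.
apply/imsetP/idP => [[x]|].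
  rewrite inE => /andP[xD /eqP<-] ->; apply: position_lt.
  by rewrite inE xD eqxx.
move/position_surj => [x]; rewrite inE => /andP[xD /eqP<-] xj.
by exists x => //; rewrite inE xD xj eqxx.
Qed.

Lemma den_CConj q s x :
  (x \in den (CConj q s)) <-> (forall D, D \in s -> (x \in den D) = q D).
Proof.
elim: s => [|D s IH] /=; first by split=> // _; exact: denT.
rewrite inE; split=> [/andP[xD /IH xs] E|H].
  rewrite inE => /predU1P[->|/xs//]; move: xD; case: (q D) => //.
  by rewrite inE => /negbTE.
apply/andP; split; last by apply/IH => E Es; apply: H; rewrite inE Es orbT.
by have := H D (mem_head _ _); case: (q D) => //; rewrite inE => ->.
Qed.

Lemma den_iter_CIm i D : den (iter i (@CIm c) D) = [set iter i f x | x in den D]%SET.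
Proof.
elim: i => [|i IH] /=; first by rewrite imset_id.
by rewrite IH -imset_comp.
Qed.

Lemma card_CHeavy i k w : w \notin den (CHeavy i k) ->
  (k * #|[set y | iter i f y == w]%SET| <= #|T|)%N.
Proof. by rewrite inE -ltnNge => /ltnW. Qed.

(** The fibres of [iter i f] are disjoint, and each heavy one takes at least a fraction [1/k] of the
    domain. *)
Lemma card_den_CHeavy i k : (0 < #|T|)%N -> (#|den (CHeavy i k)| <= k)%N.
Proof.
move=> T0; rewrite -(leq_pmul2r T0).
have : (\sum_(w in den (CHeavy i k)) #|T| <=
    \sum_(w in den (CHeavy i k)) k * #|[set y | iter i f y == w]%SET|)%N.
  by apply: leq_sum => w; rewrite inE.
rewrite sum_nat_const => /leq_trans; apply.
rewrite -big_distrr leq_mul2l; apply/orP; right.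
have -> : (\sum_(w in den (CHeavy i k)) #|[set y | iter i f y == w]%SET| =
    #|[set y | iter i f y \in den (CHeavy i k)]%SET|)%N.
  move: (den (CHeavy i k)) => W; rewrite -[RHS]sum1dep_card.
  rewrite [RHS](partition_big (iter i f) (mem W))//=.
  apply: eq_bigr => w wH; rewrite -sum1dep_card; apply: eq_bigl => y.
  by case: eqP => [->|_]; rewrite ?wH ?andbF.
exact: max_card.
Qed.

End denotation.

Lemma den_CRankE (c : nat) (T : finType) (M : mapping c T) j D x :
  (x \in den M (CRank j D)) = (x \in den M D) &&
    (position [set y in den M D | mfn M y == mfn M x]%SET x == j).
Proof. by rewrite [LHS]finset.in_set. Qed.

Lemma den_CAndE (c : nat) (T : finType) (M : mapping c T) D E x :
  (x \in den M (CAnd D E)) = (x \in den M D) && (x \in den M E).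
Proof. exact: finset.in_setI. Qed.

Lemma den_CAndP (c : nat) (T : finType) (M : mapping c T) D E x :
  x \in den M (CAnd D E) -> x \in den M D /\ x \in den M E.
Proof. by rewrite den_CAndE => /andP. Qed.

(** * Types in the ultraproduct *)

Section ultraproduct.
Context {U : set_system nat} {UU : UltraFilter U}.
Context {c : nat} (F : nat -> finite_mapping c).

Local Notation V n := (fm_dom (F n)).
Local Notation f n := (mfn (fm_map (F n))).
Local Notation dn n := (den (fm_map (F n))).

Definition upoint : Type := forall n, V n.

Lemma fm_point_ex n : exists x : V n, True.
Proof. by have /card_gt0P[x _] := fm_dom_gt0 (F n); exists x. Qed.

Definition upoint0 : upoint := fun n => sval (cid (fm_point_ex n)).

Definition umap (m : upoint) : upoint := fun n => f n (m n).

Definition ueq (m m' : upoint) : Prop := U (fun n => m n = m' n).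

Definition utype (m : upoint) : code c -> bool :=
  fun D => `[< U (fun n => m n \in dn n D) >].

Implicit Types (m u v : upoint) (D E : code c) (q : code c -> bool).

Lemma utypeP m D : utype m D <-> U (fun n => m n \in dn n D).
Proof. by split => /asboolP. Qed.

Lemma ueq_refl m : ueq m m. Proof. exact: filterE. Qed.

Lemma ueq_sym m m' : ueq m m' -> ueq m' m.
Proof. by apply: filterS => n. Qed.

Lemma ueq_trans m m' m'' : ueq m m' -> ueq m' m'' -> ueq m m''.
Proof. by move=> H H'; apply: filterS (filterI H H') => n [-> ->]. Qed.

Lemma ueq_umap m m' : ueq m m' -> ueq (umap m) (umap m').
Proof. by apply: filterS => n; rewrite /umap => ->. Qed.

Lemma ueq_iter i m m' : ueq m m' -> ueq (iter i umap m) (iter i umap m').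
Proof. by move=> mm'; elim: i => //= i; exact: ueq_umap. Qed.

Lemma iter_umapE i m n : iter i umap m n = iter i (f n) (m n).
Proof. by elim: i => //= i; rewrite /umap => ->. Qed.

Lemma utype_ueq m m' : ueq m m' -> utype m = utype m'.
Proof.
move=> mm'; apply/funext => D; apply/idP/idP => /utypeP H; apply/utypeP.
  by apply: filterS (filterI mm' H) => n [<-].
by apply: filterS (filterI mm' H) => n [->].
Qed.

Lemma utypeN m D : utype m (CNot D) = ~~ utype m D.
Proof.
apply/idP/idP => [/utypeP H|/negP H].
  apply/negP => /utypeP; apply: (ultraN (fun n => m n \in dn n D)).1.
  by apply: filterS H => n; rewrite inE => /negP.
apply/utypeP; have : ~ U (fun n => m n \in dn n D) by move/utypeP.
by move=> /((ultraN (fun n => m n \in dn n D)).2); apply: filterS => n /negP; rewrite inE.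
Qed.

Lemma utype_CPre m D : utype m (CPre D) = utype (umap m) D.
Proof.
by apply/idP/idP => /utypeP H; apply/utypeP; apply: filterS H => n; rewrite inE.
Qed.

Lemma utype_umap m : utype (umap m) = shift_type (utype m).
Proof. by apply/funext => D; rewrite -utype_CPre. Qed.

Lemma utype_iter_CPre i m D :
  utype m (iter i (@CPre c) D) = utype (iter i umap m) D.
Proof. by elim: i m => //= i IH m; rewrite utype_CPre IH -iterSr. Qed.

Lemma utype_CIm m D : utype m D -> utype (umap m) (CIm D).
Proof.
by move=> /utypeP H; apply/utypeP; apply: filterS H => n; exact: imset_f.
Qed.

Lemma utype_CNth_ueq s D m m' :
  utype m (CNth s D) -> utype m' (CNth s D) -> ueq m m'.
Proof.
move=> /utypeP H /utypeP H'; apply: filterS (filterI H H') => n [].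
exact: den_CNth_eq.
Qed.

Lemma utype_CRank_ueq j D m m' : utype m (CRank j D) -> utype m' (CRank j D) ->
  ueq (umap m) (umap m') -> ueq m m'.
Proof.
move=> /utypeP H /utypeP H' H''.
apply: filterS (filterI (filterI H H') H'') => n [[]].
exact: den_CRank_eq.
Qed.

Lemma utype_CLoop k m : utype m (CLoop k) <-> ueq (iter k umap m) m.
Proof.
split=> [/utypeP H|H]; last apply/utypeP; apply: filterS H => n.
  by rewrite inE iter_umapE => /eqP.
by rewrite iter_umapE inE => ->.
Qed.

(** The two colours tell a point from a different iterate of it; without them [f] could acquire new
    cycles in the limit. *)
Lemma utype_color k m : utype m = utype (iter k umap m) ->
  ueq (iter k umap m) m.
Proof.
move=> eqt; apply: contrapT => /((ultraN (fun n => iter k umap m n = m n)).2) H.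
have : U (fun n =>
    (m n \in dn n (CAsc k)) != (iter k umap m n \in dn n (CAsc k)) \/
    (m n \in dn n (CDesc k)) != (iter k umap m n \in dn n (CDesc k))).
  by apply: filterS H => n; rewrite iter_umapE => /eqP; exact: den_color.
have no D : ~ U (fun n => (m n \in dn n D) != (iter k umap m n \in dn n D)).
  move=> HD; have [mD|/negP mD] := boolP (utype m D).
    have /utypeP mkD : utype (iter k umap m) D by rewrite -eqt.
    have /utypeP {}mD := mD; apply: (@filter_not_empty _ U _).
    by apply: filterS (filterI HD (filterI mD mkD)) => n [h [a b]]; rewrite a b in h.
  have /negP mkD : ~ utype (iter k umap m) D by rewrite -eqt.
  have {}mD : utype m (CNot D) by rewrite utypeN; apply/negP.
  have {}mkD : utype (iter k umap m) (CNot D) by rewrite utypeN.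
  move/utypeP : mD => mD; move/utypeP : mkD => mkD.
  apply: (@filter_not_empty _ U _).
  apply: filterS (filterI HD (filterI mD mkD)) => n [h []].
  by rewrite !inE => /negbTE a /negbTE b; rewrite a b in h.
by move=> /((ultraU (fun n => (m n \in dn n (CAsc k)) !=
  (iter k umap m n \in dn n (CAsc k))) _).1) [/no|/no].
Qed.

(** [f] is injective on the points fixed by its [k]-th iterate, so such a point has no sibling of
    this kind. *)
Lemma utype_CLoop_CRank k m : (0 < k)%N -> utype m (CLoop k) ->
  utype m (CRank 0 (CLoop k)).
Proof.
case: k => // k _ /utypeP H; apply/utypeP; apply: filterS H => n mL.
apply: den_unique_CRank => // y; move: mL; rewrite !inE.
by rewrite !iterSr => /eqP {2}<- /eqP {2}<- ->.
Qed.

Lemma utype_CNth_CRank s D m : utype m (CNth s D) ->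
  utype m (CRank 0 (CNth s D)).
Proof.
move=> /utypeP H; apply/utypeP; apply: filterS H => n mL.
by apply: den_unique_CRank => // y yL _; exact: den_CNth_eq yL mL.
Qed.

(* Hence an unnamed preimage of a named point has infinitely many siblings of
   its type, and keeps a free row of bits in the limit. *)
Lemma utype_CNth_CRank_pre s D j E m : utype (umap m) (CNth s D) ->
  utype m (CRank j E) ->
  utype m (CNth 0 (CAnd (CRank j E) (CPre (CNth s D)))).
Proof.
move=> /utypeP H /utypeP H'; apply/utypeP; apply: filterS (filterI H H') => n [].
rewrite /umap => fm mR; set W := CAnd _ _.
have mW : m n \in dn n W by rewrite inE mR inE.
rewrite inE mW /= -leqn0 -ltnS.
have <- : #|dn n W| = 1%N.
  rewrite (_ : dn n W = [set m n]%SET) ?cards1//.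
  apply/setP => y; rewrite finset.in_set1; apply/idP/eqP => [|->//].
  rewrite inE => /andP[yR]; rewrite inE => fy.
  by apply: den_CRank_eq yR mR _; exact: den_CNth_eq fy fm.
exact: position_lt.
Qed.

Lemma utype_CNth_umap s D m : utype m (CNth s D) ->
  utype (umap m) (CNth 0 (CIm (CNth s D))).
Proof.
move=> /utypeP H; apply/utypeP; apply: filterS H => n mL.
set W := CIm _; have mW : umap m n \in dn n W by apply: imset_f.
rewrite inE mW /= -leqn0 -ltnS.
have <- : #|dn n W| = 1%N.
  rewrite (_ : dn n W = [set umap m n]%SET) ?cards1//.
  apply/setP => y; rewrite finset.in_set1; apply/imsetP/eqP => [[x xL ->]|->].
    by rewrite /umap (den_CNth_eq xL mL).
  by exists (m n).
exact: position_lt.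
Qed.

Lemma utype_CConj m s : utype m (CConj (utype m) s).
Proof.
apply/utypeP.
have : U (fun n => forall D, D \in s -> (m n \in dn n D) = utype m D).
  apply: ultra_all => D _; have [mD|mD] := boolP (utype m D).
    exact/utypeP.
  have /utypeP : utype m (CNot D) by rewrite utypeN.
  by apply: filterS => n; rewrite inE => /negbTE.
by apply: filterS => n /den_CConj.
Qed.

Hypothesis Uoo : \oo `<=` U.

Lemma utype_eqP m q : utype m = q <->
  forall D, U (fun n => (m n \in dn n D) = q D).
Proof.
split=> [<- D|H].
  have [mD|mD] := boolP (utype m D); first exact/utypeP.
  have /utypeP : utype m (CNot D) by rewrite utypeN.
  by apply: filterS => n; rewrite inE => /negbTE.
apply/funext => D; move: (H D); case: (q D) => HD.
  exact/utypeP.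
apply/negbTE; rewrite -utypeN; apply/utypeP.
by apply: filterS HD => n; rewrite inE => ->.
Qed.

(** By saturation the realised types form a closed subset of the Cantor space. *)
Lemma utype_compact q :
  (forall s : seq (code c), exists m, forall D, D \in s -> utype m D = q D) ->
  exists m, utype m = q.
Proof.
move=> H.
have [|m Hm] := @saturation U _ Uoo _ upoint0 (code c)
    (fun D n => [set x | (x \in dn n D) = q D]).
  move=> s; have [m Hm] := H s.
  have : U (fun n => forall D, D \in s -> (m n \in dn n D) = q D).
    by apply: ultra_all => D Ds; have /utype_eqP := erefl (utype m); rewrite -Hm.
  by apply: filterS => n Hn; exists (m n).
by exists m; apply/utype_eqP.
Qed.

(** The type of [u] contains [CIm C] for every finite piece [C] of the type of [v0], so each piece
    has a witness in the fibre of [u]; saturation finds a common one. *)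
Lemma utype_preimage v0 u : utype u = shift_type (utype v0) ->
  exists v, ueq (umap v) u /\ utype v = utype v0.
Proof.
move=> uv.
have [|v Hv] := @saturation U _ Uoo _ upoint0 (code c)
    (fun D n => [set x | f n x = u n /\ (x \in dn n D) = utype v0 D]).
  move=> s; have : utype u (CIm (CConj (utype v0) s)).
    rewrite uv /shift_type utype_CPre.
    by apply: utype_CIm; exact: utype_CConj.
  move=> /utypeP; apply: filterS => n /imsetP[x /den_CConj xs ->].
  by exists x => D Ds; split=> //; exact: xs.
exists v; split; first by apply: filterS (Hv CTrue) => n [].
by apply/utype_eqP => D; apply: filterS (Hv D) => n [].
Qed.

Lemma utype_preimage_infinite v0 u (y : nat -> upoint) :
  utype u = shift_type (utype v0) ->
  (forall j D, ~~ utype v0 (CRank j D)) ->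
  exists v, [/\ ueq (umap v) u, utype v = utype v0 & forall k, ~ ueq v (y k)].
Proof.
move=> uv norank.
have large C K : utype v0 C -> utype u (CIm (CRank K C)).
  move=> v0C; rewrite uv /shift_type utype_CPre; apply/utypeP.
  have no j : ~ U (fun n => v0 n \in dn n (CRank j C)).
    by move/utypeP; apply/negP.
  (* A bounded position would be constant on a set of [U], hence recorded in the type, against
     [norank]. So the fibre holds more than [K] realisations of [C], enough to avoid finitely many
     of the [y k]. *)
  have : ~ U (fun n => exists2 j, (j < K.+1)%N & v0 n \in dn n (CRank j C)).
    by move/ultra_exists_lt => [j _ /no].
  move=> /((ultraN (fun n => exists2 j, (j < K.+1)%N & v0 n \in dn n (CRank j C))).2) H.
  move/utypeP : v0C => v0C; apply: filterS (filterI H v0C) => n [Hn v0n].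
  rewrite /umap den_CIm_CRank; set E := [set _ in _ | _]%SET.
  have v0E : v0 n \in E by rewrite inE v0n eqxx.
  apply: leq_ltn_trans (position_lt v0E); rewrite leqNgt; apply/negP => lt.
  by apply: Hn; exists (position E (v0 n)); [exact: ltnW|rewrite inE v0n eqxx].
have [|v Hv] := @saturation U _ Uoo _ upoint0 (code c + nat)%type
    (fun i n => match i with
       | inl D => [set x | f n x = u n /\ (x \in dn n D) = utype v0 D]
       | inr k => [set x | x <> y k n] end).
  move=> s; pose sl := pmap (fun i => if i is inl D then Some D else None) s.
  pose sr := pmap (fun i => if i is inr k then Some k else None) s.
  have /utypeP := large _ (size sr) (utype_CConj v0 sl).
  apply: filterS => n; rewrite den_CIm_CRank; set E := [set _ in _ | _]%SET => lt.
  have [x xE xy] : exists2 x, x \in E & x \notin [seq y k n | k <- sr].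
    apply: contrapT => H; move: lt; rewrite ltnNge => /negP; apply.
    rewrite -(size_map (y^~ n)); apply: leq_trans (card_size _).
    apply/subset_leq_card/fintype.subsetP => x xE; apply: contrapT => /negP xy.
    by apply: H; exists x.
  move: xE; rewrite inE => /andP[/den_CConj xs /eqP fx].
  exists x => -[D|k] si /=.
    by split=> //; apply: xs; rewrite mem_pmap; apply/mapP; exists (inl D).
  move=> xk; move/negP: xy; apply; apply/mapP; exists k => //.
  by rewrite mem_pmap; apply/mapP; exists (inr k).
exists v; split.
- by apply: filterS (Hv (inl CTrue)) => n [].
- by apply/utype_eqP => D; apply: filterS (Hv (inl D)) => n [].
- move=> k vk; apply: (@filter_not_empty _ U _).
  by apply: filterS (filterI vk (Hv (inr k))) => n [].
Qed.

Definition named q := exists i s D, q (iter i (@CPre c) (CNth s D)).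

(** When no iterate is named, every image under an iterate of [f] of a finite piece of the type is
    unboundedly large, which leaves room to avoid all the given orbits. *)
Lemma utype_generic v0 p (y : 'I_p -> upoint) : ~ named (utype v0) ->
  exists v, utype v = utype v0 /\
    forall i j a, ~ ueq (iter i umap v) (iter j umap (y a)).
Proof.
move=> nn.
have large C N K : utype v0 C ->
    U (fun n => (K < #|dn n (iter N (@CIm c) C)|)%N).
  move=> v0C; pose W := iter N (@CIm c) C.
  have no j : ~ U (fun n => iter N umap v0 n \in dn n (CNth j W)).
    by move=> H; apply: nn; exists N, j, W; rewrite utype_iter_CPre; apply/utypeP.
  have : ~ U (fun n => exists2 j, (j < K.+1)%N & iter N umap v0 n \in dn n (CNth j W)).
    by move/ultra_exists_lt => [j _ /no].
  move=> /((ultraN (fun n => exists2 j, (j < K.+1)%N & iter N umap v0 n \in dn n (CNth j W))).2) H.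
  move/utypeP : v0C => v0C; apply: filterS (filterI H v0C) => n [Hn v0n].
  have v0W : iter N umap v0 n \in dn n W.
    by rewrite den_iter_CIm iter_umapE; apply: imset_f.
  apply: leq_ltn_trans (position_lt v0W); rewrite leqNgt; apply/negP => lt.
  apply: Hn; exists (position (dn n W) (iter N umap v0 n)); first exact: ltnW.
  by rewrite inE v0W eqxx.
have [|v Hv] := @saturation U _ Uoo _ upoint0 (code c + nat * nat)%type
    (fun i n => match i with
       | inl D => [set x | (x \in dn n D) = utype v0 D]
       | inr (i, j) => [set x | forall a : 'I_p, iter i (f n) x <> iter j (f n) (y a n)]
       end).
  move=> s; pose sl := pmap (fun i => if i is inl D then Some D else None) s.
  pose sr := pmap (fun i => if i is inr k then Some k else None) s.
  pose N := \max_(k <- sr) maxn k.1 k.2.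
  (* If [f^i(x) = f^j(y a)] with [i, j <= N], then [f^N(x) = f^(N-i+j)(y a)], with exponent at most
     [N + N]. It is thus enough that [f^N(x)] avoids [Y n]. *)
  pose Y n := [seq iter l (f n) (y a n) | l <- iota 0 (N + N).+1, a <- enum 'I_p].
  have := large _ N ((N + N).+1 * p)%N (utype_CConj v0 sl).
  apply: filterS => n lt.
  have [w wC wY] : exists2 w, w \in dn n (iter N (@CIm c) (CConj (utype v0) sl)) &
      w \notin Y n.
    apply: contrapT => H; move: lt; rewrite ltnNge => /negP; apply.
    rewrite (_ : (_ * _)%N = size (Y n)); last first.
      by rewrite size_allpairs size_iota size_enum_ord.
    apply: leq_trans (card_size _).
    apply/subset_leq_card/fintype.subsetP => x xE; apply: contrapT => /negP xy.
    by apply: H; exists x.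
  move: wC; rewrite den_iter_CIm => /imsetP[x /den_CConj xs wx].
  exists x => -[D|[i j]] si /=.
    by apply: xs; rewrite mem_pmap; apply/mapP; exists (inl D).
  have ijs : (i, j) \in sr by rewrite mem_pmap; apply/mapP; exists (inr (i, j)).
  have : (maxn i j <= N)%N.
    exact: (@leq_bigmax_seq _ sr xpredT (fun k => maxn k.1 k.2) (i, j)).
  rewrite geq_max => /andP[iN jN] a xa; move/negP: wY; apply.
  apply/allpairsP; exists ((N - i + j)%N, a); split.
  - by rewrite mem_iota add0n ltnS leq_add//= leq_subr.
  - by rewrite mem_enum.
  - by rewrite wx /= iterD -xa -iterD subnK.
exists v; split.
- by apply/utype_eqP => D; exact: (Hv (inl D)).
- move=> i j a vk; apply: (@filter_not_empty _ U _).
  apply: filterS (filterI vk (Hv (inr (i, j)))) => n [va /(_ a) Hn].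
  by apply: Hn; move: va; rewrite !iter_umapE.
Qed.

End ultraproduct.

(** * The limit and the back-and-forth *)

Section terms.
Variable p : nat.

Fixpoint term_var (t : term p) : 'I_p :=
  match t with TVar i => i | TApp t' => term_var t' end.

Fixpoint term_depth (t : term p) : nat :=
  match t with TVar _ => 0 | TApp t' => (term_depth t').+1 end.

Lemma term_evalE c T (M : mapping c T) (v : p.-tuple T) (t : term p) :
  term_eval M v t = iter (term_depth t) (mfn M) (tnth v (term_var t)).
Proof. by elim: t => //= t ->. Qed.

End terms.

Section limit_points.
Context {U : set_system nat} {UU : UltraFilter U} (Uoo : \oo `<=` U).
Context {c : nat} (F : nat -> finite_mapping c).

Local Notation umap := (@umap c F).
Local Notation utype := (@utype U c F).
Local Notation ueq := (@ueq U c F).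
Implicit Types (m u v : upoint F) (D E : code c) (q : code c -> bool).

Definition forces (l : nat) D : Prop :=
  match l with
  | 0 => exists i s E, D = iter i (@CPre c) (CNth s E)
  | l'.+1 => exists j E, D = iter l' (@CPre c) (CRank j E)
  end.

Definition masked q l := exists D, forces l D /\ q D.

Lemma masked0 q : masked q 0 <-> named q.
Proof.
split=> [[_ [[i [s [E ->]]] qD]]|[i [s [E qD]]]]; first by exists i, s, E.
by eexists; split; [exists i, s, E|].
Qed.

Lemma masked_rank q j E : q (CRank j E) -> masked q 1.
Proof. by move=> qE; exists (CRank j E); split=> //; exists j, E. Qed.

Lemma masked_shift q l : masked (shift_type q) l.+1 <-> masked q l.+2.
Proof.
split=> [[_ [[j [E ->]] qD]]|[_ [[j [E ->]] qD]]].
  by exists (iter l.+1 (@CPre c) (CRank j E)); split=> //; exists j, E.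
by exists (iter l (@CPre c) (CRank j E)); split=> //; exists j, E.
Qed.

Lemma named_shift m : named (shift_type (utype m)) <-> named (utype m).
Proof.
split=> [[i [s [E qD]]]|]; first by exists i.+1, s, E.
move=> [[|i] [s [E qD]]]; last by exists i, s, E.
by exists 0%N, 0%N, (CIm (CNth s E)); rewrite /= -utype_umap; exact: utype_CNth_umap.
Qed.

(* A point of the limit is a type together with random bits: row 0 labels the
   connected component, and row l.+1 tells the l-th iterate apart from its
   siblings of the same type.  The rows vanish as soon as the type leaves no
   room for several copies. *)
Record lpoint := LPoint {
  ltype : code c -> bool;
  lbits : nat -> nat -> bool;
  lrealized : exists m, utype m = ltype;
  lmasked : forall l, masked ltype l -> forall k, lbits l k = false
}.

Implicit Types x y z : lpoint.

Lemma lpoint_eq x y : ltype x = ltype y -> lbits x = lbits y -> x = y.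
Proof.
case: x y => [q b r k] [q' b' r' k'] /= qq bb.
by move: r k r' k'; rewrite qq bb => *; congr LPoint; exact: Prop_irrelevance.
Qed.

Definition shift_bits (b : nat -> nat -> bool) l := b (if l is 0 then 0 else l.+1)%N.

Lemma lmap_realized x : exists m, utype m = shift_type (ltype x).
Proof. by have [m <-] := lrealized x; exists (umap m); exact: utype_umap. Qed.

Lemma lmap_masked x l : masked (shift_type (ltype x)) l ->
  forall k, shift_bits (lbits x) l k = false.
Proof.
move=> H k; apply: lmasked; case: l H => [|l]; last by move/masked_shift.
by move/masked0 => H; apply/masked0; move: H; have [m <-] := lrealized x;
  move/named_shift.
Qed.

Definition lmap x : lpoint := LPoint (lmap_realized x) (@lmap_masked x).

Definition lmapping : mapping c lpoint :=
  Mapping lmap (fun i => [set x | ltype x (CMark i)]).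

Lemma ltype_iter i x D : ltype (iter i lmap x) D = ltype x (iter i (@CPre c) D).
Proof. by elim: i D => //= i IH D; rewrite /shift_type IH -iterSr. Qed.

Lemma ltype_iter_utype i x m : utype m = ltype x ->
  utype (iter i umap m) = ltype (iter i lmap x).
Proof. by move=> mx; elim: i => //= i <-; rewrite utype_umap. Qed.

Lemma lbits_iter0 i x : lbits (iter i lmap x) 0 = lbits x 0.
Proof. by elim: i => //= i; rewrite /shift_bits => ->. Qed.

Lemma lbits_iterS i x l : lbits (iter i lmap x) l.+1 = lbits x (i + l).+1.
Proof. by elim: i l => //= i IH l; rewrite /shift_bits IH addnS. Qed.

Lemma ltype_CNth_iter s D i x : ltype x (CNth s D) ->
  exists s' D', ltype (iter i lmap x) (CNth s' D').
Proof.
move=> H; elim: i => [|i [s' [D' IH]]]; first by exists s, D.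
exists 0%N, (CIm (CNth s' D')); rewrite iterS; move: IH.
have [m mx] := lrealized (iter i lmap x); rewrite -mx => /utype_CNth_umap.
by rewrite utype_umap mx.
Qed.

(** The iterates of a named point are named too, and a named point is ranked in its fibre, so each
    row is erased and a named point has only one copy. *)
Lemma lbits_CNth s D x : ltype x (CNth s D) -> lbits x = fun _ _ => false.
Proof.
move=> H; apply/funext => l; apply/funext => k; apply: lmasked.
case: l => [|l]; first by apply/masked0; exists 0%N, s, D.
have [s' [D' H']] := ltype_CNth_iter l H.
have [m mx] := lrealized (iter l lmap x).
have := H'; rewrite -mx => /utype_CNth_CRank; rewrite mx ltype_iter => Hl.
by eexists; split; [exists 0%N, (CNth s' D')|exact: Hl].
Qed.

Lemma ltype_CNth_eq s D x y : ltype x (CNth s D) -> ltype y (CNth s D) -> x = y.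
Proof.
move=> xD yD; apply: lpoint_eq; last by rewrite (lbits_CNth xD) (lbits_CNth yD).
have [m mx] := lrealized x; have [m' my] := lrealized y.
by rewrite -mx -my; apply: utype_ueq; apply: (@utype_CNth_ueq _ _ _ _ s D);
  rewrite ?mx ?my.
Qed.

(** The rank erases row 1, and the image shows all the other rows. *)
Lemma ltype_CRank_eq j D x y : ltype x = ltype y -> ltype x (CRank j D) ->
  lmap x = lmap y -> x = y.
Proof.
move=> xy xD fxy; apply: lpoint_eq => //; apply/funext => -[|[|l]].
- by have /(congr1 (fun z => lbits z 0%N)) := fxy.
- apply/funext => k; rewrite !lmasked//; first by rewrite -xy; exact: masked_rank xD.
  exact: masked_rank xD.
- by have /(congr1 (fun z => lbits z l.+1)) := fxy.
Qed.

(** On a cycle all iterates are ranked, so at most row 0 survives, and [lmap] preserves it.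
    Conversely, when the type returns, the colours force the ultraproduct point to return. *)
Lemma ltype_CLoop k x : ltype x (CLoop k) <-> iter k lmap x = x.
Proof.
have [m mx] := lrealized x; split; last first.
  move=> kx; have H : utype m = utype (iter k umap m).
    by rewrite (ltype_iter_utype _ mx) kx.
  by rewrite -mx; apply/utype_CLoop; exact: utype_color.
case: k => // k; rewrite -mx => mL.
have loop := mL; move/utype_CLoop in loop.
have typ : ltype (iter k.+1 lmap x) = ltype x.
  by rewrite -(ltype_iter_utype _ mx) (utype_ueq loop).
have zero l : lbits x l.+1 = fun=> false.
  apply/funext => r; apply: lmasked.
  have : utype (iter l umap m) (CRank 0 (CLoop k.+1)).
    apply: utype_CLoop_CRank => //; apply/utype_CLoop.
    by rewrite -iterD addnC iterD; exact: ueq_iter.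
  rewrite (ltype_iter_utype _ mx) ltype_iter => H.
  by eexists; split; [exists 0%N, (CLoop k.+1)|exact: H].
apply: lpoint_eq => //; apply/funext => -[|l]; first exact: lbits_iter0.
by rewrite lbits_iterS !zero.
Qed.

Lemma lmap_iter_eq i j x m : utype m = ltype x ->
  iter i lmap x = iter j lmap x <-> ueq (iter i umap m) (iter j umap m).
Proof.
move=> mx; wlog ij : i j / (i <= j)%N.
  move=> H; have [|/ltnW] := leqP i j; first exact: H.
  by move/H => [H1 H2]; split=> [/esym/H1|/ueq_sym/H2]; [exact: ueq_sym|].
have := ltype_CLoop (j - i) (iter i lmap x).
have := @utype_CLoop U _ c F (j - i) (iter i umap m).
rewrite (ltype_iter_utype _ mx) -!iterD subnK// => [[H1 H2]] [H3 H4].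
split=> [e|e]; first by apply: ueq_sym; apply: H1; apply: H4.
by apply: esym; apply: H3; apply: H2; exact: ueq_sym.
Qed.

Lemma named_iter_eq i j s D x y m v : utype m = ltype x -> utype v = ltype y ->
  ltype (iter i lmap x) (CNth s D) ->
  iter i lmap x = iter j lmap y <-> ueq (iter i umap m) (iter j umap v).
Proof.
move=> mx vy xD; split=> [xy|mv].
  apply: (@utype_CNth_ueq _ _ _ _ s D).
    by rewrite (ltype_iter_utype _ mx).
  by rewrite (ltype_iter_utype _ vy) -xy.
apply: (ltype_CNth_eq xD).
by rewrite -(ltype_iter_utype _ vy) -(utype_ueq mv) (ltype_iter_utype _ mx).
Qed.

(** * Configurations and the back-and-forth property *)

Section conf.
Variable p : nat.
Implicit Types (X : p.-tuple lpoint) (M : p.-tuple (upoint F)).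

(** Every term is an iterate of a variable, so the second clause decides all equations; the first
    decides all marks. *)
Definition conf X M :=
  (forall a, utype (tnth M a) = ltype (tnth X a)) /\
  forall a b i j, iter i lmap (tnth X a) = iter j lmap (tnth X b) <->
    ueq (iter i umap (tnth M a)) (iter j umap (tnth M b)).

Definition conf_with X M x m := utype m = ltype x /\
  forall a i j, iter i lmap x = iter j lmap (tnth X a) <->
    ueq (iter i umap m) (iter j umap (tnth M a)).

End conf.

Lemma conf_cons p (X : p.-tuple lpoint) (M : p.-tuple (upoint F)) x m :
  conf X M -> conf_with X M x m -> conf [tuple of x :: X] [tuple of m :: M].
Proof.
move=> [t e] [t' e']; split=> [a|a b i j].
  by case: (unliftP ord0 a) => [a'|] ->; rewrite ?tnthS ?tnth0.
case: (unliftP ord0 a) => [a'|] ->; case: (unliftP ord0 b) => [b'|] ->;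
  rewrite ?tnthS ?tnth0 //; last exact: lmap_iter_eq.
by split=> [/esym/e'/ueq_sym|/ueq_sym/e'/esym].
Qed.

Section extension.
Context (p : nat) (X : p.-tuple lpoint) (M : p.-tuple (upoint F)).
Hypothesis XM : conf X M.

Let XMt a : utype (tnth M a) = ltype (tnth X a). Proof. exact: XM.1. Qed.

Lemma conf_with_iter j a :
  conf_with X M (iter j lmap (tnth X a)) (iter j umap (tnth M a)).
Proof.
split=> [|b i k]; first by rewrite (ltype_iter_utype _ (XMt a)).
by rewrite -!iterD; exact: XM.2.
Qed.

Lemma conf_with_ueq x m m' : ueq m m' -> conf_with X M x m -> conf_with X M x m'.
Proof.
move=> mm' [t e]; split=> [|a i j]; first by rewrite -(utype_ueq mm').
rewrite e; split; first exact/ueq_trans/ueq_sym/ueq_iter.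
exact/ueq_trans/ueq_iter.
Qed.

Lemma conf_with_named s D x m : utype m = ltype x -> ltype x (CNth s D) ->
  conf_with X M x m.
Proof.
move=> mx xD; split=> // a i j; have [s' [D' xD']] := ltype_CNth_iter i xD.
exact: named_iter_eq xD'.
Qed.

Lemma conf_with_generic x m : utype m = ltype x ->
  (forall a i j, iter i lmap x <> iter j lmap (tnth X a)) ->
  (forall a i j, ~ ueq (iter i umap m) (iter j umap (tnth M a))) ->
  conf_with X M x m.
Proof. by move=> mx Hx Hm; split=> // a i j; split=> [/Hx|/Hm]. Qed.

(** A point off the given orbits can meet them only from its image on. *)
Lemma conf_with_child x m m' : conf_with X M (lmap x) m' ->
  utype m = ltype x -> ueq (umap m) m' ->
  (forall a j, x <> iter j lmap (tnth X a)) ->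
  (forall a j, ~ ueq m (iter j umap (tnth M a))) ->
  conf_with X M x m.
Proof.
move=> [t e] mx mm' Hx Hm; split=> // a [|i] j.
  by split=> [/Hx|/Hm].
rewrite !iterSr e; split; last exact/ueq_trans/ueq_iter/ueq_sym.
exact/ueq_trans/ueq_iter.
Qed.

Let linked x := (exists a j, x = iter j lmap (tnth X a)) \/
  exists s D, ltype x (CNth s D).

Let linkedM m := (exists a j, ueq m (iter j umap (tnth M a))) \/
  exists s D, utype m (CNth s D).

Let Morbit k := if @unpickle ('I_p * nat)%type k is Some (a, j)
  then iter j umap (tnth M a) else @upoint0 c F.

(** Induction on the number of steps to a given orbit or a named point. The partner of the image is
    pulled back, to the forced preimage if the type is ranked, otherwise to one of infinitely many
    preimages, chosen off the orbits of [M]. *)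
Lemma conf_forth_linked i x : linked (iter i lmap x) ->
  exists m, conf_with X M x m.
Proof.
elim: i x => [|i IH] x.
  move=> /= [[a [j ->]]|[s [D xD]]]; first by eexists; exact: conf_with_iter.
  have [m mx] := lrealized x; exists m; exact: conf_with_named xD.
rewrite iterSr => /IH [m' Hm'].
have [/(IH _)//|nl] := pselect (linked (iter i lmap x)).
have [a0|] := pselect (exists a j, x = iter j lmap (tnth X a)).
  by have [a [j ->]] := a0; eexists; exact: conf_with_iter.
move=> nx; have Hx a j : x <> iter j lmap (tnth X a) by move=> xa; apply: nx; exists a, j.
have [v0 v0x] := lrealized x.
have tm' : utype m' = shift_type (utype v0) by rewrite Hm'.1 v0x.
have [[j [D xD]]|nr] := pselect (exists j D, ltype x (CRank j D)).
  have [m [mm' mv0]] := utype_preimage Uoo tm'.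
  exists m; apply: (conf_with_child Hm') => //; first by rewrite mv0.
  (* Were the forced preimage on an orbit of [M], the matching point of [X] would share type, rank
     and image with [x], hence be [x]. *)
  move=> a k mk; apply: (Hx a k).
  have tk : ltype x = ltype (iter k lmap (tnth X a)).
    by rewrite -(ltype_iter_utype _ (XMt a)) -(utype_ueq mk) mv0.
  apply: (ltype_CRank_eq tk xD); rewrite -iterS.
  apply: (Hm'.2 a 0%N k.+1).2 => /=; apply: ueq_trans (ueq_sym mm') _.
  exact: ueq_umap.
have [j D|m [mm' mv0 Hm]] := utype_preimage_infinite Uoo Morbit tm'.
  by rewrite v0x; apply/negP => xD; apply: nr; exists j, D.
exists m; apply: (conf_with_child Hm') => //; first by rewrite mv0.
by move=> a j; have := Hm (pickle (a, j)); rewrite /Morbit pickleK.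
Qed.

Lemma conf_forth x : exists m, conf_with X M x m.
Proof.
have [[i xi]|nl] := pselect (exists i, linked (iter i lmap x)).
  exact: conf_forth_linked xi.
have [v0 v0x] := lrealized x.
have nn : ~ named (utype v0).
  move=> [i [s [D]]]; rewrite v0x -ltype_iter => H.
  by apply: nl; exists i; right; exists s, D.
have [m [mv0 Hm]] := utype_generic Uoo (tnth M) nn.
exists m; apply: conf_with_generic => //; first by rewrite mv0.
by move=> a i j ij; apply: nl; exists i; left; exists a, j.
Qed.

(** For a preimage of [x] of type [q], only row 1 is free; the other rows are those of [x]. *)
Lemma child_masked (x : lpoint) q (b : nat -> bool) :
  (exists m, utype m = q) -> shift_type q = ltype x ->
  (masked q 1 -> forall k, b k = false) ->
  forall l, masked q l -> forall k,
    (match l with 0 => lbits x 0 | 1 => b | l'.+2 => lbits x l'.+1 end) k = false.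
Proof.
move=> [m mq] qx Hb [|[|l]] // H k; apply: lmasked; rewrite -qx.
  by apply/masked0; rewrite -mq; apply/named_shift; rewrite mq; apply/masked0.
by apply/masked_shift.
Qed.

Lemma conf_back_linked i m : linkedM (iter i umap m) ->
  exists x, conf_with X M x m.
Proof.
elim: i m => [|i IH] m.
  move=> /= [[a [j mj]]|[s [D mD]]].
    by eexists; apply: conf_with_ueq (ueq_sym mj) _; exact: conf_with_iter.
  have real : exists m', utype m' = utype m by exists m.
  pose x := @LPoint (utype m) (fun _ _ => false) real (fun _ _ _ => erefl).
  by exists x; exact: (@conf_with_named s D).
rewrite iterSr => /IH [x' Hx'].
have [a0|] := pselect (exists a j, ueq m (iter j umap (tnth M a))).
  have [a [j mj]] := a0; eexists.
  by apply: conf_with_ueq (ueq_sym mj) _; exact: conf_with_iter.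
move=> nm; have Hm a j : ~ ueq m (iter j umap (tnth M a)).
  by move=> ma; apply: nm; exists a, j.
have real : exists m', utype m' = utype m by exists m.
have qx' : shift_type (utype m) = ltype x' by rewrite -utype_umap Hx'.1.
have [[j [D mD]]|nr] := pselect (exists j D, utype m (CRank j D)).
  pose x := LPoint real (@child_masked x' _ (fun=> false) real qx' (fun _ _ => erefl)).
  have xx' : lmap x = x' by apply: lpoint_eq => //; apply/funext => -[].
  exists x; apply: (@conf_with_child x m (umap m)) => //; first by rewrite xx'.
    exact: ueq_refl.
  move=> a k xk; apply: (Hm a k).
  have tk : utype (iter k umap (tnth M a)) = utype m.
    by rewrite (ltype_iter_utype _ (XMt a)) -xk.
  apply: (@utype_CRank_ueq _ _ _ _ j D) => //; first by rewrite tk.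
  by apply: (Hx'.2 a 0%N k.+1).1; rewrite /= -xk.
(* A diagonal row: at place [(a, j)] it differs from row 1 of the [j]-th iterate of [tnth X a],
   which keeps the new point off all the orbits. *)
pose b k := if @unpickle ('I_p * nat)%type k is Some (a, j)
  then ~~ lbits (iter j lmap (tnth X a)) 1 k else false.
have nmask : ~ masked (utype m) 1.
  by move=> [_ [[j [D ->]] mD]]; apply: nr; exists j, D.
have Hb : masked (utype m) 1 -> forall k, b k = false by move/nmask.
pose x := LPoint real (@child_masked x' _ b real qx' Hb).
have xx' : lmap x = x' by apply: lpoint_eq => //; apply/funext => -[].
exists x; apply: (@conf_with_child x m (umap m)) => //; first by rewrite xx'.
  exact: ueq_refl.
move=> a k xk; have : lbits x 1 (pickle (a, k)) = b (pickle (a, k)) by [].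
by rewrite xk /b pickleK; case: lbits.
Qed.

Lemma conf_back m : exists x, conf_with X M x m.
Proof.
have [[i xi]|nl] := pselect (exists i, linkedM (iter i umap m)).
  exact: conf_back_linked xi.
have nn : ~ named (utype m).
  move=> [i [s [D]]]; rewrite utype_iter_CPre => H.
  by apply: nl; exists i; right; exists s, D.
have real : exists m', utype m' = utype m by exists m.
(* Row 0 is constant along orbits, so differing at place [a] from that of [tnth X a] separates the
   whole orbits. *)
pose t k := if insub k is Some a then ~~ lbits (tnth X a) 0 k else false.
pose b (l : nat) := if l is 0 then t else fun=> false.
have bmask l : masked (utype m) l -> forall k, b l k = false.
  by case: l => // /masked0/nn.
exists (LPoint real bmask); apply: conf_with_generic => //; last first.
  by move=> a i j ij; apply: nl; exists i; left; exists a, j.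
move=> a i j /(congr1 (fun z => lbits z 0%N a)); rewrite !lbits_iter0 /= /t.
by rewrite valK; case: lbits.
Qed.

End extension.

Definition utuple p (M : p.-tuple (upoint F)) n : p.-tuple (fm_dom (F n)) :=
  map_tuple (fun m : upoint F => m n) M.

Lemma utuple_cons p (M : p.-tuple (upoint F)) m n :
  utuple [tuple of m :: M] n = [tuple of m n :: utuple M n].
Proof. exact: val_inj. Qed.

(** In the existential case a witness moves to the ultraproduct by [conf_forth] and back by
    [conf_back]; passing to coordinates is the argument of Los. *)
Lemma sat_conf p (phi : formula c p) (X : p.-tuple lpoint) M : conf X M ->
  sat lmapping phi X <-> U (fun n => sat (fm_map (F n)) phi (utuple M n)).
Proof.
elim: phi X M => {p} [p t1 t2|p i t|p phi IH|p phi IH1 psi IH2|p phi IH] X M XM /=.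
- rewrite !term_evalE XM.2.
  by split; apply: filterS => n; rewrite !term_evalE !tnth_map -!iter_umapE.
- rewrite term_evalE /= -(ltype_iter_utype _ (XM.1 _)); split.
    move/utypeP; apply: filterS => n; rewrite inE => /asboolP.
    by rewrite term_evalE tnth_map iter_umapE.
  move=> H; apply/utypeP; apply: filterS H => n.
  by rewrite term_evalE tnth_map -iter_umapE inE => /asboolP.
- by rewrite (IH _ _ XM) ultraN.
- by rewrite (IH1 _ _ XM) (IH2 _ _ XM) ultraI.
- have := ultra_exists (@upoint0 c F)
    (fun n (w : fm_dom (F n)) => sat (fm_map (F n)) phi [tuple of w :: utuple M n]).
  rewrite /upoint => -> ; split=> [[x]|[m]].
    have [m xm] := conf_forth XM x; rewrite (IH _ _ (conf_cons XM xm)) => H.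
    by exists m; apply: filterS H => n; rewrite utuple_cons.
  have [x xm] := conf_back XM m => H; exists x.
  by rewrite (IH _ _ (conf_cons XM xm)); apply: filterS H => n; rewrite utuple_cons.
Qed.

Lemma conf_forth_tuple p (X : p.-tuple lpoint) : exists M, conf X M.
Proof.
elim: p X => [X|p IH X]; first by exists [tuple]; split=> -[].
case/tupleP: X => x X; have [M XM] := IH X; have [m xm] := conf_forth XM x.
by exists [tuple of m :: M]; exact: conf_cons.
Qed.

Lemma conf_back_tuple p (M : p.-tuple (upoint F)) : exists X, conf X M.
Proof.
elim: p M => [M|p IH M]; first by exists [tuple]; split=> -[].
case/tupleP: M => m M; have [X XM] := IH M; have [x xm] := conf_back XM m.
by exists [tuple of x :: X]; exact: conf_cons.
Qed.

End limit_points.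

(** * Borel structure and definable sets *)

Section first_difference.
Context {T : Type} (e : nat -> T -> bool).
Implicit Types x y z : T.

Definition agree n x y := forall k, (k < n)%N -> e k x = e k y.

Context (R : realType).

(** The usual ultrametric of the Cantor space, pulled back along [e]. *)
Definition code_dist x y : R :=
  if pselect (exists k, e k x != e k y) is left H then (2 ^+ ex_minn H)^-1 else 0.

Lemma code_dist_lt n x y : code_dist x y < (2 ^+ n)^-1 <-> agree n.+1 x y.
Proof.
rewrite /code_dist; case: pselect => [H|nH]; last first.
  split=> [_ k _|_]; last by rewrite invr_gt0 exprn_gt0.
  by apply/eqP; apply: contrapT => /negP xy; apply: nH; exists k.
case: ex_minnP => m em minm.
rewrite ltf_pV2 ?posrE ?exprn_gt0// ltr_eXn2l ?ltr1n//; split=> [nm k kn|Hag].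
  apply/eqP; apply: contrapT => /negP/minm mk.
  by have := leq_trans nm (leq_trans mk kn); rewrite ltnn.
by rewrite ltnNge; apply/negP => mn; move: em; rewrite Hag ?eqxx.
Qed.

Lemma code_dist_ge0 x y : 0 <= code_dist x y.
Proof. by rewrite /code_dist; case: pselect => // H; rewrite invr_ge0 exprn_ge0. Qed.

Lemma code_distxx x : code_dist x x = 0.
Proof.
by rewrite /code_dist; case: pselect => // H; exfalso; have [k] := H; rewrite eqxx.
Qed.

Lemma code_dist_sym x y : code_dist x y = code_dist y x.
Proof.
rewrite /code_dist; case: pselect => [H|H]; case: pselect => [H'|H'] //.
- congr (_ ^+ _)^-1; case: ex_minnP => m em minm; case: ex_minnP => n en minn.
  by apply/eqP; rewrite eqn_leq minm ?minn// eq_sym.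
- by case: H' ; have [k] := H; exists k; rewrite eq_sym.
- by case: H ; have [k] := H'; exists k; rewrite eq_sym.
Qed.

Lemma code_dist_triangle y x z :
  code_dist x z <= code_dist x y + code_dist y z.
Proof.
rewrite {1}/code_dist; case: pselect => [H|H]; last first.
  by rewrite addr_ge0 ?code_dist_ge0.
case: ex_minnP => m em _; rewrite leNgt; apply/negP => lt.
have lt1 : code_dist x y < (2 ^+ m)^-1.
  by apply: le_lt_trans lt; rewrite lerDl code_dist_ge0.
have lt2 : code_dist y z < (2 ^+ m)^-1.
  by apply: le_lt_trans lt; rewrite lerDr code_dist_ge0.
have /code_dist_lt a1 := lt1; have /code_dist_lt a2 := lt2.
by move: em; rewrite a1 ?a2 ?eqxx.
Qed.

End first_difference.

Section coded_space.
Context (R : realType) (T : choiceType) (e : nat -> T -> bool).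
Hypothesis e_inj : forall x y, (forall k, e k x = e k y) -> x = y.

(* An alias of T, whose arguments are those of the metric it carries. *)
Definition coded_space (_ : realType)
  (_ : forall x y, (forall k, e k x = e k y) -> x = y) : Type := T.
Local Notation X := (coded_space R e_inj).

Lemma code_dist_eq0 (x y : X) : code_dist e R x y = 0 -> x = y.
Proof.
move=> xy; apply: e_inj => k.
have /code_dist_lt : code_dist e R x y < (2 ^+ k)^-1 by rewrite xy invr_gt0 exprn_gt0.
exact.
Qed.

HB.instance Definition _ := Choice.on X.
HB.instance Definition _ := @isMetric.Build R X (code_dist e R)
  (@code_distxx _ e R) code_dist_eq0 (@code_dist_sym _ e R)
  (@code_dist_triangle _ e R).

Lemma coded_ballE (x y : X) r : ball x r y <-> code_dist e R x y < r.
Proof. by rewrite ballEmdist. Qed.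

Lemma coded_ball_agree (x : X) (r : R) : 0 < r ->
  exists n, forall y : X, agree e n x y -> ball x r y.
Proof.
move=> r0; have [n Hn] : exists n, (2 ^+ n : R)^-1 < r.
  exists (Num.bound r^-1); rewrite invf_plt ?posrE ?exprn_gt0//.
  have r1 : 0 <= r^-1 by rewrite invr_ge0 ltW.
  apply: lt_trans (archi_boundP r1) _.
  by rewrite -natrX ltr_nat ltn_expl.
exists n.+1 => y /(code_dist_lt e R) xy; rewrite coded_ballE.
exact: lt_trans xy Hn.
Qed.

Lemma coded_agree_ball (x y : X) n : ball x ((2 ^+ n : R)^-1) y -> agree e n.+1 x y.
Proof. by rewrite coded_ballE => /code_dist_lt. Qed.

Lemma open_cylinder n (x : X) : open [set y : X | agree e n x y].
Proof.
rewrite openE => y xy; rewrite /interior; apply/nbhs_ballP.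
exists ((2 ^+ n)^-1) => /=; first by rewrite invr_gt0 exprn_gt0.
by move=> z /coded_agree_ball yz k kn; rewrite xy// yz// ltnW.
Qed.

Hypothesis e_closed : forall w : nat -> bool,
  (forall n, exists x, forall k, (k < n)%N -> e k x = w k) ->
  exists x, forall k, e k x = w k.

(** The coordinates of a Cauchy sequence stabilise, and [e_closed] makes the stable values the code
    of a point. *)
Lemma polish_coded_space : polish (R := R) X.
Proof.
split=> [u cu|].
  have stab k : exists N, forall n, (N <= n)%N -> e k (u n) = e k (u N).
    have /cauchy_ballP /(_ ((2 ^+ k)^-1)) H := cu.
    have [|[A B] [[N _ HA] [N' _ HB]] AB] := H; first by rewrite invr_gt0 exprn_gt0.
    exists (maxn N N') => n; rewrite geq_max => /andP[Nn N'n].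
    apply/esym/(coded_agree_ball (AB (u (maxn N N'), u n) _)) => //.
    by split; [apply: HA; rewrite /= leq_maxl|exact: HB].
  have [N HN] := choice stab.
  have [|l Hl] := e_closed (w := fun k => e k (u (N k))).
    move=> n; exists (u (\max_(k < n) N k)) => k kn; apply: HN.
    exact: (leq_bigmax (Ordinal kn)).
  exists l; apply/cvg_ballP => r r0; have [n Hn] := coded_ball_agree l r0.
  exists (\max_(k < n) N k) => // i /= Ni; apply: Hn => k kn; rewrite Hl; apply/esym/HN.
  by apply: leq_trans Ni; exact: (leq_bigmax (Ordinal kn)).
pose P (s : seq bool) (x : X) := forall k, (k < size s)%N -> e k x = nth false s k.
(* One chosen point of the cylinder of [s], or nothing if the cylinder is empty. *)
pose D s := [set x : X | exists H : exists x, P s x, x = sval (cid H)].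
exists (\bigcup_s D s).
  apply: bigcup_countable => // s _.
  have [H|nH] := pselect (exists x, P s x).
    apply: (@sub_countable _ _ _ [set sval (cid H)]) => //.
    apply: subset_card_le => x [H' ->] /=; congr (sval (cid _)).
    exact: Prop_irrelevance.
  by rewrite (_ : D s = set0)//; apply/seteqP; split=> // x [H].
move=> O [x Ox] oO.
have /nbhs_ballP[r /= r0 rO] : nbhs x O by exact: open_nbhs_nbhs.
have [n Hn] := coded_ball_agree x r0.
pose s := [seq e k x | k <- iota 0 n].
have H : exists x, P s x.
  exists x => k; rewrite size_map size_iota => kn.
  by rewrite (nth_map 0%N) ?size_iota// nth_iota.
exists (sval (cid H)); split; last by exists s => //; exists H.
apply: rO; apply: Hn => k kn.
rewrite (svalP (cid H)) ?size_map ?size_iota//.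
by rewrite (nth_map 0%N) ?size_iota// nth_iota.
Qed.

End coded_space.

Section standard_borel_coded.
Context (R : realType) (d : measure_display) (L : measurableType d).
Variable e : nat -> L -> bool.
Hypothesis e_inj : forall x y, (forall k, e k x = e k y) -> x = y.
Hypothesis e_closed : forall w : nat -> bool,
  (forall n, exists x, forall k, (k < n)%N -> e k x = w k) ->
  exists x, forall k, e k x = w k.
Hypothesis e_measurable : forall k, measurable [set x | e k x].
Hypothesis e_generates : forall A : set L, measurable A ->
  <<s [set B | exists k, B = [set x | e k x]] >> A.
Local Notation X := (coded_space R e_inj).

Lemma measurable_cylinder (s : seq bool) :
  measurable [set y | forall k, (k < size s)%N -> e k y = nth false s k].
Proof.
rewrite (_ : [set y | _] = \bigcap_(k in [set k | (k < size s)%N])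
    (if nth false s k then [set y | e k y] else ~` [set y | e k y])).
  apply: bigcap_measurableType => // k _.
  by case: ifP => _; [|apply: measurableC]; exact: e_measurable.
apply/seteqP; split=> y Hy k /= ks; have := Hy k ks.
  by case: nth => /= [->//|/negP].
by case: nth => //= /negP/negbTE.
Qed.

Lemma open_measurable_coded (O : set X) : open O -> measurable (O : set L).
Proof.
move=> oO; pose C (s : seq bool) :=
  [set y | forall k, (k < size s)%N -> e k y = nth false s k].
rewrite (_ : O = \bigcup_s (if pselect (C s `<=` O) then C s else set0)).
  apply: countable_bigcupT_measurable => // s.
  case: pselect => sO /=; [exact: measurable_cylinder|exact: measurable0].
apply/seteqP; split=> [x Ox|x [s _]]; last by case: pselect => sO //= /sO.
have /nbhs_ballP[r /= r0 rO] : nbhs (x : X) O by exact: open_nbhs_nbhs.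
have [n Hn] := @coded_ball_agree R L e e_inj x r r0.
pose s := [seq e k x | k <- iota 0 n].
have sE k : (k < n)%N -> nth false s k = e k x.
  by move=> kn; rewrite (nth_map 0%N) ?size_iota// nth_iota.
exists s => //; case: pselect => [sO|[]] /=.
  by move=> k; rewrite size_map size_iota => kn; rewrite sE.
move=> y Hy; apply: rO; apply: Hn => k kn.
by rewrite Hy ?sE// size_map size_iota.
Qed.

Lemma standard_borel_coded : standard_borel R L.
Proof.
exists (coded_space R e_inj : metricType R), (fun x => x); split.
- exact: polish_coded_space.
- by exists (fun x => x).
move=> A; split=> [mA|[B gB ->]].
  exists A => //; have := e_generates mA; apply: smallest_sub.
    exact: smallest_sigma_algebra.
  move=> _ [k ->]; apply: sub_sigma_algebra.
  rewrite /= openE => x kx; rewrite /interior.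
  have := @open_cylinder R L e e_inj k.+1 x; rewrite openE => /(_ x) H.
  by apply: filterS (H _) => // y /= /(_ k) <-.
rewrite /preimage /=; move: B gB; apply: smallest_sub.
  exact: sigma_algebra_measurable.
by move=> O /open_measurable_coded.
Qed.

End standard_borel_coded.

(** [A] is a union of atoms of the Boolean algebra generated by finitely many [B i]. *)
Lemma measurable_finite_invariant d (T : measurableType d) (I : eqType)
    (B : I -> set T) (s : seq I) (A : set T) :
  (forall i, measurable (B i)) ->
  (forall x y, (forall i, i \in s -> B i x <-> B i y) -> A x -> A y) ->
  measurable A.
Proof.
move=> mB; elim: s A => [|i s IH] A HA.
  have [[x Ax]|nA] := pselect (exists x, A x).
    rewrite (_ : A = setT) //; apply/seteqP; split=> // y _.
    exact: HA Ax.
  rewrite (_ : A = set0) //; apply/seteqP; split=> // y Ay; apply: nA.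
  by exists y.
(* The saturation, for the remaining indices, of the part of [A] where [B i] has truth value [b]. *)
pose A1 (b : Prop) := [set x | exists y, [/\ (B i y <-> b), A y &
  forall j, j \in s -> B j y <-> B j x]].
have mA1 b : measurable (A1 b).
  apply: IH => x y xy [z [zb Az zx]]; exists z; split=> // j js.
  by rewrite (zx j js); exact: xy.
rewrite (_ : A = (B i `&` A1 True) `|` (~` B i `&` A1 False)).
  apply: measurableU; apply: measurableI => //; exact: measurableC.
apply/seteqP; split=> x.
  move=> Ax; have [Bx|nBx] := pselect (B i x).
    by left; split=> //; exists x.
  by right; split=> //; exists x.
move=> [[Bx]|[Bx]] [y [yb Ay yx]]; apply: (HA y) => // j.
  by rewrite inE => /predU1P[->|/yx//]; split=> _ //; apply/yb.
by rewrite inE => /predU1P[->|/yx//]; split=> [/yb|/Bx].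
Qed.

Section limit_space.
Context {U : set_system nat} {UU : UltraFilter U} (Uoo : \oo `<=` U).
Context {c : nat} (F : nat -> finite_mapping c).
Local Notation lpoint := (@lpoint U c F).

Lemma lpoint0_realized : exists m, @utype U c F m = @utype U c F (upoint0 F).
Proof. by exists (upoint0 F). Qed.

Definition lpoint0 : lpoint :=
  @LPoint U c F _ (fun _ _ => false) lpoint0_realized (fun _ _ _ => erefl).

HB.instance Definition _ := gen_eqMixin lpoint.
HB.instance Definition _ := gen_choiceMixin lpoint.
HB.instance Definition _ := isPointed.Build lpoint lpoint0.

Definition lcoord (i : code c + nat * nat) (x : lpoint) : bool :=
  match i with inl D => ltype x D | inr (l, k) => lbits x l k end.

Definition lgen : set (set lpoint) := range (fun i => [set x | lcoord i x]).

Definition lspace : Type := g_sigma_algebraType lgen.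
HB.instance Definition _ := Measurable.on lspace.

Lemma measurable_lcoord i : measurable [set x : lspace | lcoord i x].
Proof. by apply: sub_sigma_algebra; exists i. Qed.

Lemma measurable_ltype D : measurable [set x : lspace | ltype x D].
Proof. exact: (measurable_lcoord (inl D)). Qed.

Lemma measurable_lbits l k : measurable [set x : lspace | lbits x l k].
Proof. exact: (measurable_lcoord (inr (l, k))). Qed.

Lemma lcoord_inj (x y : lpoint) : (forall i, lcoord i x = lcoord i y) -> x = y.
Proof.
move=> H; apply: lpoint_eq.
  by apply/funext => D; exact: (H (inl D)).
by apply/funext => l; apply/funext => k; exact: (H (inr (l, k))).
Qed.

Lemma measurable_fun_lspace d (T : measurableType d) (g : T -> lspace) :
  (forall i, measurable [set z | lcoord i (g z)]) -> measurable_fun setT g.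
Proof.
move=> H; apply: (@measurability _ _ T lspace setT g lgen) => //.
by move=> _ [_ [i _ <-] <-]; rewrite setTI; exact: H.
Qed.

Lemma measurable_lmap : measurable_fun setT (@lmap U UU c F : lspace -> lspace).
Proof.
apply: measurable_fun_lspace => -[D|[l k]] /=.
  exact: (measurable_ltype (CPre D)).
by rewrite /shift_bits; exact: measurable_lbits.
Qed.

Lemma measurable_iter_lmap i : measurable_fun setT (iter i (@lmap U UU c F) : lspace -> lspace).
Proof.
elim: i => [|i IH]; first exact: measurable_id.
exact: (measurableT_comp measurable_lmap IH).
Qed.

Lemma measurable_lspace_eq d (T : measurableType d) (g h : T -> lspace) :
  measurable_fun setT g -> measurable_fun setT h ->
  measurable [set z | g z = h z].
Proof.
move=> mg mh.
have mi (k : T -> lspace) i : measurable_fun setT k -> measurable [set z | lcoord i (k z)].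
  move=> mk; have := mk measurableT _ (measurable_lcoord i).
  by rewrite setTI.
rewrite (_ : [set z | _] = ~` \bigcup_i
    (([set z | lcoord i (g z)] `&` ~` [set z | lcoord i (h z)]) `|`
     (~` [set z | lcoord i (g z)] `&` [set z | lcoord i (h z)]))).
  apply: measurableC; apply: countable_bigcupT_measurable => // i.
  by apply: measurableU; apply: measurableI; do ?apply: measurableC; apply: mi.
apply/seteqP; split=> z /= H.
  by move=> [i _]; rewrite /= H => -[] [].
apply: lcoord_inj => i; apply/idP/idP => Hi; apply: contrapT => nHi; apply: H.
  by exists i => //; left.
by exists i => //; right.
Qed.

Definition lcode (k : nat) (x : lspace) : bool :=
  if @pickle_inv (code c + nat * nat)%type k is Some i then lcoord i x else false.

Lemma lcodeK i x : lcode (pickle i) x = lcoord i x.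
Proof. by rewrite /lcode pickleK_inv. Qed.

(** The codes of points form a closed set: realised types do by compactness, and erasure is a
    conjunction of clopen conditions, one for each code forcing a row and each bit of that row. *)
Lemma standard_borel_lspace (R : realType) : standard_borel R lspace.
Proof.
refine (@standard_borel_coded R _ lspace lcode _ _ _ _).
- by move=> x y H; apply: lcoord_inj => i; rewrite -!lcodeK.
- move=> w Hw.
  pose q D := w (pickle (inl D : code c + nat * nat)%type).
  pose b l k := w (pickle (inr (l, k) : code c + nat * nat)%type).
  have approx (s : seq (code c + nat * nat)%type) : exists x,
      forall i, i \in s -> lcoord i x = w (pickle i).
    have [x Hx] := Hw (\max_(i <- s) (pickle i).+1).
    exists x => i si; rewrite -lcodeK Hx//.
    exact: (@leq_bigmax_seq _ s xpredT (fun i => (pickle i).+1) i).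
  have real : exists m, @utype U c F m = q.
    apply: utype_compact => // s; have [x Hx] := approx (map inl s).
    have [m mx] := lrealized x; exists m => D Ds; rewrite mx.
    by rewrite -[LHS]/(lcoord (inl D) x) Hx // map_f.
  have mask l : masked q l -> forall k, b l k = false.
    move=> [D [lD qD]] k; have [x Hx] := approx [:: inl D; inr (l, k)].
    rewrite -[LHS](Hx (inr (l, k))) ?inE ?eqxx ?orbT//=; apply: lmasked.
    by exists D; split=> //; rewrite -[ltype x D]/(lcoord (inl D) x) Hx ?mem_head.
  exists (LPoint real mask) => k; have [x Hx] := Hw k.+1.
  have := Hx k (leqnn _); rewrite /lcode.
  case E : (@pickle_inv (code c + nat * nat)%type k) => [i|//] _.
  have <- : pickle i = k.
    by have := @pickle_invK (code c + nat * nat)%type k; rewrite /oapp E.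
  by case: i {E} => [D|[l k']].
- move=> k; rewrite /lcode; case E : (@pickle_inv (code c + nat * nat)%type k) => [i|].
    exact: measurable_lcoord.
  by rewrite (_ : [set x | false] = set0)//; apply/seteqP; split.
- move=> A; apply: smallest_sub; first exact: smallest_sigma_algebra.
  move=> _ [i _ <-]; apply: sub_sigma_algebra; exists (pickle i).
  by apply/seteqP; split=> x /=; rewrite lcodeK.
Qed.

(** * Borel measurability of definable sets *)

Section definable.
Variable p : nat.
Local Notation tindex := (('I_p * code c) + ('I_p * 'I_p * (nat * nat)))%type.

Definition tcoord (i : tindex) : set (p.-tuple lspace) :=
  match i with
  | inl (a, D) => [set X | ltype (tnth X a) D]
  | inr (a, b, (i, j)) =>
      [set X | iter i (@lmap U UU c F) (tnth X a) = iter j (@lmap U UU c F) (tnth X b)]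
  end.

Lemma measurable_tcoord i : measurable (tcoord i).
Proof.
case: i => [[a D]|[[a b] [i j]]] /=.
  have := @measurable_tnth _ lspace p a measurableT _ (measurable_ltype D).
  by rewrite setTI.
apply: measurable_lspace_eq.
  exact: (measurableT_comp (measurable_iter_lmap i) (measurable_tnth a)).
exact: (measurableT_comp (measurable_iter_lmap j) (measurable_tnth b)).
Qed.

Definition fcoord (i : tindex) n
    (v : p.-tuple (fm_dom (F n))) : Prop :=
  match i with
  | inl (a, D) => tnth v a \in den (fm_map (F n)) D
  | inr (a, b, (i, j)) =>
      iter i (mfn (fm_map (F n))) (tnth v a) = iter j (mfn (fm_map (F n))) (tnth v b)
  end.

(** Splits [conf] into countably many conditions, Borel on the side of [L] and evaluated
    coordinatewise in the ultraproduct, as compactness requires. *)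
Lemma conf_coord (X : p.-tuple lpoint) M :
  conf X M <-> forall i, tcoord i X <-> U (fun n => fcoord i (utuple M n)).
Proof.
split=> [[t e] [[a D]|[[a b] [i j]]]|H]; last split=> [a|a b i j].
- rewrite /= -t; split.
    by move/utypeP; apply: filterS => n; rewrite tnth_map.
  by move=> H; apply/utypeP; apply: filterS H => n; rewrite tnth_map.
- rewrite /= e; split; apply: filterS => n; by rewrite !tnth_map -!iter_umapE.
- apply/funext => D; have := H (inl (a, D)); rewrite /= => HD.
  apply/idP/idP => [/utypeP mD|/HD mD]; last apply/utypeP.
    by apply/HD; apply: filterS mD => n; rewrite tnth_map.
  by apply: filterS mD => n; rewrite tnth_map.
- have := H (inr (a, b, (i, j))); rewrite /= => ->.
  by split; apply: filterS => n; rewrite !tnth_map -!iter_umapE.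
Qed.

Lemma utuple_ex (v : forall n, p.-tuple (fm_dom (F n))) :
  exists M : p.-tuple (upoint F), forall n, utuple M n = v n.
Proof.
exists [tuple (fun n => tnth (v n) a) | a < p] => n.
by apply: eq_from_tnth => a; rewrite tnth_map tnth_mktuple.
Qed.

(* Quantifier elimination by compactness. *)
Lemma sat_finite_coord (phi : formula c p) :
  exists s : seq tindex, forall M M' : p.-tuple (upoint F),
    (forall i, i \in s ->
      U (fun n => fcoord i (utuple M n)) <-> U (fun n => fcoord i (utuple M' n))) ->
    U (fun n => sat (fm_map (F n)) phi (utuple M n)) ->
    U (fun n => sat (fm_map (F n)) phi (utuple M' n)).
Proof.
apply: contrapT => /forallNP H.
pose G n := (p.-tuple (fm_dom (F n)) * p.-tuple (fm_dom (F n)))%type.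
pose g0 n : G n := (utuple [tuple upoint0 F | _ < p] n, utuple [tuple upoint0 F | _ < p] n).
have iffU (P Q : nat -> Prop) : (U P <-> U Q) -> U (fun n => P n <-> Q n).
  move=> [PQ QP]; have [hP|nP] := pselect (U P).
    by apply: filterS (filterI hP (PQ hP)) => n [].
  have nQ : ~ U Q by move/QP.
  have hP : U (fun n => ~ P n) by exact/ultraN.
  have hQ : U (fun n => ~ Q n) by exact/ultraN.
  by apply: (filterS _ (filterI hP hQ)) => n [a b]; split.
have [|w Hw] := @saturation U UU Uoo G g0
    (option tindex)
    (fun i n => if i is Some i then [set w | fcoord i w.1 <-> fcoord i w.2]
      else [set w | sat (fm_map (F n)) phi w.1 /\ ~ sat (fm_map (F n)) phi w.2]).
  move=> s; have /existsNP[M /existsNP[M' /not_implyP[MM' /not_implyP[sM sM']]]] := H (pmap id s).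
  have sN : U (fun n => ~ sat (fm_map (F n)) phi (utuple M' n)) by exact/ultraN.
  have agree : U (fun n => forall i, i \in pmap id s ->
      fcoord i (utuple M n) <-> fcoord i (utuple M' n)).
    by apply: ultra_all => i si; apply: iffU; exact: MM'.
  apply: filterS (filterI agree (filterI sM sN)) => n [Ha [Hs Hn]].
  exists (utuple M n, utuple M' n) => -[i|] si //=.
  by apply: Ha; rewrite mem_pmap; apply/mapP; exists (Some i).
have [M HM] := utuple_ex (fun n => (w n).1).
have [M' HM'] := utuple_ex (fun n => (w n).2).
have [X XM] := conf_back_tuple M.
have XM' : conf X M'.
  apply/conf_coord => i; rewrite (conf_coord X M).1//.
  split=> Hi; apply: filterS (filterI Hi (Hw (Some i))) => n [];
    by rewrite HM HM' => a [b b']; auto.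
have sX : sat (@lmapping U UU c F) phi X.
  by apply/(sat_conf Uoo phi XM); apply: filterS (Hw None) => n []; rewrite HM.
have := (sat_conf Uoo phi XM').1 sX => sM'.
apply: (@filter_not_empty _ U _).
by apply: filterS (filterI sM' (Hw None)) => n []; rewrite HM' => + [].
Qed.

Lemma measurable_sat (phi : formula c p) :
  measurable [set X : p.-tuple lspace | sat (@lmapping U UU c F) phi X].
Proof.
have [s Hs] := sat_finite_coord phi.
apply: (measurable_finite_invariant (s := s) measurable_tcoord) => X Y XY.
have [M XM] := conf_forth_tuple Uoo X; have [M' YM'] := conf_forth_tuple Uoo Y.
move=> /(sat_conf Uoo phi XM) sM; apply/(sat_conf Uoo phi YM').
apply: Hs sM => i si.
by rewrite -(conf_coord X M).1// -(conf_coord Y M').1//; exact: XY.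
Qed.

End definable.

Lemma modeling_lspace (R : realType) : modeling_mapping R (@lmapping U UU c F : mapping c lspace).
Proof. by split; [exact: standard_borel_lspace|move=> p phi; exact: measurable_sat]. Qed.

End limit_space.

(** * The measure on the limit *)

Section loeb_maps.
Context (R : realType) {U : set_system nat} {UU : UltraFilter U}.
Hypothesis Uoo : \oo `<=` U.

Lemma loeb_ext (G : nat -> finType) (g0 : forall n, G n)
    (m1 m2 : {measure set (loeb_type g0) -> \bar R}) :
  (forall D, m1 (internal D) = m2 (internal D)) -> (m1 setT < +oo)%E ->
  forall A, measurable A -> m1 A = m2 A.
Proof.
move=> m12 m1oo.
apply: (@g_sigma_algebra_measure_unique _ R (loeb_type g0) (@internals U G g0) _ (fun=> setT)).
- by move=> _ [D _ <-]; exact: measurable_internal.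
- by move=> _; exists (fun n => [set: G n]%SET) => //; exact: internalT.
- by rewrite bigcup_const//; exists 0%N.
- exact: internalsI.
- by move=> _ [D _ <-].
- by [].
Qed.

Definition uprod_map (G H : nat -> finType) (g0 : forall n, G n)
    (h0 : forall n, H n) (h : forall n, H n -> G n) :
    loeb_type h0 -> loeb_type g0 :=
  fun (y : forall n, H n) n => h n (y n).

Lemma measurable_uprod_map (G H : nat -> finType) (g0 : forall n, G n)
    (h0 : forall n, H n) (h : forall n, H n -> G n) :
  measurable_fun setT (@uprod_map G H g0 h0 h).
Proof.
apply: (@measurability _ _ (loeb_type h0) (loeb_type g0) setT _ (@internals U G g0)) => //.
move=> _ [_ [D _ <-] <-]; rewrite setTI.
rewrite (_ : _ @^-1` _ = @internal U H h0 (fun n => h n @^-1: D n)%SET).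
  exact: measurable_internal.
by apply/seteqP; split=> y; apply: filterS => n; rewrite inE.
Qed.

Lemma density_prod (G1 G2 H : nat -> finType) (g1 : forall n, G1 n)
    (g2 : forall n, G2 n) (h0 : forall n, H n) (W : forall n, {set H n})
    (D : forall n, {set G1 n}) (E : forall n, {set G2 n}) :
  (forall n, #|W n| = #|D n| * #|E n|)%N -> (forall n, #|H n| = #|G1 n| * #|G2 n|)%N ->
  density R (U := U) W = density R (U := U) (G := G1) D * density R (U := U) (G := G2) E.
Proof.
move=> cW cH; apply: ulimE.
have cM : (ratio R D \* ratio R E) @ U -->
    density R (U := U) D * density R (U := U) E.
  by apply: cvgM; exact: cvg_density.
apply: (cvg_trans _ cM).
apply: near_eq_cvg; apply: filterE => n.
by rewrite /ratio /= cW cH !natrM invfM mulrACA.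
Qed.

Local Notation P g := (@loeb R U UU Uoo _ g).

Local Open Scope ereal_scope.

(** The Loeb sigma-algebra of a product generally exceeds the product sigma-algebra, so independence
    needs an argument: it is a count on internal rectangles, extended to measurable sides one at a
    time. The maps only have to count like projections, so that [H] may consist of tuples. *)
Lemma loeb_prod (G1 G2 H : nat -> finType) (g1 : forall n, G1 n)
    (g2 : forall n, G2 n) (h0 : forall n, H n)
    (h1 : forall n, H n -> G1 n) (h2 : forall n, H n -> G2 n) :
  (forall n (D : {set G1 n}) (E : {set G2 n}),
    #|[set x | (h1 n x \in D) && (h2 n x \in E)]%SET| = #|D| * #|E|)%N ->
  (forall n, #|H n| = #|G1 n| * #|G2 n|)%N ->
  forall (A : set (loeb_type g1)) (B : set (loeb_type g2)),
  measurable A -> measurable B ->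
  loeb R Uoo (@uprod_map G1 H g1 h0 h1 @^-1` A `&` @uprod_map G2 H g2 h0 h2 @^-1` B)
  = loeb R Uoo A * loeb R Uoo B.
Proof.
move=> ch cH A B mA mB.
set f1 := @uprod_map G1 H g1 h0 h1.
set f2 := @uprod_map G2 H g2 h0 h2.
have mf1 : measurable_fun setT f1 by exact: measurable_uprod_map.
have mf2 : measurable_fun setT f2 by exact: measurable_uprod_map.
have mpre1 A' : measurable A' -> measurable (f1 @^-1` A').
  by move=> mA'; rewrite -[X in measurable X]setTI; exact: mf1.
have mpre2 B' : measurable B' -> measurable (f2 @^-1` B').
  by move=> mB'; rewrite -[X in measurable X]setTI; exact: mf2.
have step1 D A' : measurable A' ->
    P h0 (f1 @^-1` A' `&` f2 @^-1` internal D) = P g1 A' * P g2 (internal D).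
  move=> mA'; have mD := @measurable_internal U UU G2 g2 D.
  have r0 : (0 <= fine (P g2 (internal D)))%R by rewrite fine_ge0.
  have rE : (fine (P g2 (internal D)))%:E = P g2 (internal D).
    by rewrite fineK// fin_num_measure.
  have scE X : mscale (NngNum r0) (P g1) X = P g1 X * P g2 (internal D).
    by rewrite /mscale /= rE muleC.
  transitivity (mscale (NngNum r0) (P g1) A'); last exact: scE.
  transitivity (pushforward (mrestr (P h0) (mpre2 _ mD)) f1 A') => //.
  apply: loeb_ext => //; last first.
    rewrite /pushforward /mrestr; apply: le_lt_trans (_ : 1 < +oo); last exact: ltry.
    by apply: probability_le1; apply: measurableI => //; [exact: mpre1|exact: mpre2].
  move=> D1; apply: etrans (esym (scE _)).
  change (P h0 (f1 @^-1` internal D1 `&` f2 @^-1` internal D) =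
    P g1 (internal D1) * P g2 (internal D)).
  rewrite !loebE -EFinM.
  rewrite (_ : _ `&` _ = @internal U H h0 (fun n =>
      [set x | (h1 n x \in D1 n) && (h2 n x \in D n)]%SET)).
    rewrite loebE; congr (_%:E).
    exact: (density_prod g1 g2 h0).
  apply/seteqP; split=> y.
    by move=> [a b]; apply: filterS (filterI a b) => n [/= a' b']; rewrite inE a' b'.
  by move=> H'; split; apply: filterS H' => n; rewrite inE => /andP[].
have r0 : (0 <= fine (P g1 A))%R by rewrite fine_ge0.
have rE : (fine (P g1 A))%:E = P g1 A by rewrite fineK// fin_num_measure.
have scE X : mscale (NngNum r0) (P g2) X = P g1 A * P g2 X.
  by rewrite /mscale /= rE.
transitivity (mscale (NngNum r0) (P g2) B); last exact: scE.
transitivity (pushforward (mrestr (P h0) (mpre1 _ mA)) f2 B).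
  by rewrite /pushforward /mrestr setIC.
apply: loeb_ext => //; last first.
  rewrite /pushforward /mrestr; apply: le_lt_trans (_ : 1 < +oo); last exact: ltry.
  by apply: probability_le1; apply: measurableI => //; [exact: mpre2|exact: mpre1].
move=> D; apply: etrans (esym (scE _)); apply: etrans (step1 _ _ mA).
by rewrite setIC.
Qed.

End loeb_maps.

(** * Counting in finite powers and random bits *)

Section tuple_counting.
Context {T : finType} {p : nat}.
Implicit Types (v : p.-tuple T) (a : 'I_p) (x : T).

Definition tset a x v : p.-tuple T := [tuple if b == a then x else tnth v b | b < p].

Lemma tnth_tset a x v : tnth (tset a x v) a = x.
Proof. by rewrite tnth_mktuple eqxx. Qed.

Lemma tnth_tset_neq a b x v : a != b -> tnth (tset a x v) b = tnth v b.
Proof. by move=> ab; rewrite tnth_mktuple eq_sym (negbTE ab). Qed.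

(** Fubini by resampling the [a]-th entry: the involution [th] swaps it with the fresh value, whence
    [#|Q| = #|W| * #|T|]. *)
Lemma card_tset (W : {set p.-tuple T}) a k :
  (forall v, #|[set x | tset a x v \in W]%SET| * k <= #|T|)%N ->
  (#|W| * k <= #|T| ^ p)%N.
Proof.
move=> H; have [T0|T0] := posnP #|T|.
  have := max_card (mem W); rewrite card_tuple T0 exp0n ?leqn0; last first.
    by apply: leq_ltn_trans (ltn_ord a).
  by move=> /eqP ->; rewrite mul0n.
pose Q := [set z : p.-tuple T * T | tset a z.2 z.1 \in W]%SET.
pose th (z : p.-tuple T * T) := (tset a z.2 z.1, tnth z.1 a).
have thK : involutive th.
  move=> [v x]; rewrite /th /=; congr pair; last by rewrite tnth_mktuple eqxx.
  apply: eq_from_tnth => b; rewrite tnth_mktuple.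
  by case: eqP => [->//|/eqP ba]; rewrite tnth_mktuple (negbTE ba).
have cQ : #|Q| = (#|W| * #|T|)%N.
  rewrite -[#|T|]cardsT -cardsX -(card_imset _ (inv_inj thK)).
  apply: eq_card => z; apply/imsetP/idP => [[y yQ ->]|].
    by rewrite !inE in yQ *; rewrite yQ.
  rewrite !inE andbT => zW; exists (th z); last by rewrite thK.
  by rewrite inE -[tset _ _ _]/((th (th z)).1) thK.
have : (#|Q| * k <= #|T| ^ p * #|T|)%N.
  have -> : #|Q| = (\sum_(v : p.-tuple T) #|[set x | tset a x v \in W]%SET|)%N.
    rewrite -sum1_card [RHS](eq_bigr (fun v => \sum_(x | tset a x v \in W) 1)%N); last first.
      by move=> v _; rewrite sum1dep_card.
    rewrite [RHS]pair_big_dep /=; apply: eq_bigl => z.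
    by rewrite /Q inE.
  rewrite big_distrl /=.
  apply: (@leq_trans (\sum_(v : p.-tuple T) #|T|)%N); first by apply: leq_sum => v _.
  by rewrite sum_nat_const card_tuple.
by rewrite cQ mulnAC leq_pmul2r.
Qed.

End tuple_counting.

Lemma card_tuple_pair (T1 T2 : finType) p (P : pred (p.-tuple T1)) :
  #|[set v : p.-tuple (T1 * T2) | P (map_tuple fst v)]%SET| =
  (#|[set v | P v]%SET| * #|T2| ^ p)%N.
Proof.
rewrite -card_tuple -cardsT -cardsX.
pose g (v : p.-tuple (T1 * T2)) := (map_tuple fst v, map_tuple snd v).
have gi : injective g.
  move=> v w [/= e1 e2]; apply: eq_from_tnth => a.
  have := congr1 (fun s => nth (tnth v a).1 s a) e1.
  have := congr1 (fun s => nth (tnth v a).2 s a) e2.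
  rewrite /= !(nth_map (tnth v a)) ?size_tuple// -!tnth_nth => h2 h1.
  by rewrite [LHS]surjective_pairing h1 h2 -surjective_pairing.
rewrite -(card_imset _ gi); apply: eq_card => -[w1 w2].
apply/imsetP/idP => [[v]|]; first by rewrite inE => Pv ->; rewrite !inE Pv.
rewrite !inE andbT => Pw; pose v := [tuple (tnth w1 a, tnth w2 a) | a < p].
have v1 : map_tuple fst v = w1 by apply: eq_from_tnth => a; rewrite tnth_map tnth_mktuple.
have v2 : map_tuple snd v = w2 by apply: eq_from_tnth => a; rewrite tnth_map tnth_mktuple.
by exists v; rewrite ?inE /g ?v1 ?v2.
Qed.

Lemma card_tuple_cons (T : finType) p (D : {set T}) (E : {set p.-tuple T}) :
  #|[set v : p.+1.-tuple T | (thead v \in D) && ([tuple of behead v] \in E)]%SET| =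
  (#|D| * #|E|)%N.
Proof.
rewrite -cardsX; pose g (v : p.+1.-tuple T) := (thead v, [tuple of behead v]).
have gi : injective g.
  move=> v w [/= e1 e2]; rewrite (tuple_eta v) (tuple_eta w); apply: val_inj => /=.
  by congr cons.
rewrite -(card_imset _ gi); apply: eq_card => -[x w].
apply/imsetP/idP => [[v]|]; first by rewrite inE => Pv ->; rewrite !inE.
rewrite !inE /= => xw; exists [tuple of x :: w].
  rewrite inE theadE (_ : [tuple of behead _] = w) //.
  exact: val_inj.
by rewrite /g theadE; congr pair; exact: val_inj.
Qed.

Section random_bits.
Variable n : nat.

(* The rows 1, ..., n+1 are permuted cyclically by the shift below. *)
Definition bits : finType := {ffun 'I_n.+2 -> {ffun 'I_n -> bool}}.

(** Bits out of range are false; fixed [l] and [k] are in range for all large [n]. *)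
Definition bit (w : bits) (l k : nat) : bool :=
  if insub l is Some l' then if insub k is Some k' then w l' k' else false
  else false.

(** Flipping bit [K] sends the event on [K.+1] bits to a disjoint copy inside the event on [K] bits,
    so each further bit at least halves the count. *)
Lemma card_bits_prefix l (b : nat -> bool) K : (l < n.+2)%N -> (K <= n)%N ->
  (#|[set w | [forall k : 'I_K, bit w l k == b k]]%SET| * 2 ^ K <= #|bits|)%N.
Proof.
move=> ln; elim: K => [|K IH] Kn; first by rewrite muln1 max_card.
apply: leq_trans (IH (ltnW Kn)); rewrite expnS mulnA leq_mul2r; apply/orP; right.
set W' := [set w | _]%SET; set W := [set w | _]%SET.
pose l0 : 'I_n.+2 := Ordinal ln; pose K0 : 'I_n := Ordinal Kn.
pose flip (w : bits) : bits := [ffun i => [ffun j => w i j (+) ((i == l0) && (j == K0))]].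
have bitE w (k : 'I_n) : bit w l k = w l0 k.
  rewrite /bit (insubT (fun l => l < n.+2)%N ln) valK.
  by congr (w _ _); exact: val_inj.
have flipK : involutive flip.
  by move=> w; apply/ffunP => i; apply/ffunP => j; rewrite !ffunE addbK.
have sub1 : W' \subset W.
  apply/fintype.subsetP => w; rewrite !inE => /forallP H; apply/forallP => k.
  exact: (H (widen_ord (leqnSn K) k)).
have sub2 : flip @: W' \subset W.
  apply/fintype.subsetP => _ /imsetP[w + ->]; rewrite !inE => /forallP H.
  apply/forallP => k; have /eqP /= <- := H (widen_ord (leqnSn K) k).
  have kn : (k < n)%N by apply: leq_trans (ltnW Kn); exact: ltn_ord.
  have bkE w' : bit w' l k = w' l0 (Ordinal kn) := bitE w' (Ordinal kn).
  rewrite !bkE !ffunE eqxx /= (_ : Ordinal kn == K0 = false) ?addbF//.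
  by apply/eqP => /(congr1 val) /= kK; have := ltn_ord k; rewrite kK ltnn.
have disj : W' :&: flip @: W' = finset.set0.
  apply/setP => w; rewrite !inE; apply/negP => /andP[/forallP H].
  move=> /imsetP[w']; rewrite inE => /forallP H' ww'.
  have /eqP := H ord_max; have /eqP /= <- := H' ord_max.
  have bKE v : bit v l K = v l0 K0 := bitE v K0.
  by rewrite ww' /= !bKE !ffunE !eqxx /=; case: (w' _ _).
have := cardsUI W' (flip @: W'); rewrite disj cards0 addn0 card_imset; last exact: inv_inj.
rewrite addnn -muln2 => <-; apply: subset_leq_card.
apply/fintype.subsetP => w; rewrite inE.
by move=> /orP[]; [move/fintype.subsetP: sub1|move/fintype.subsetP: sub2]; exact.
Qed.

End random_bits.

Section limit_measure.
Context (R : realType) {U : set_system nat} {UU : UltraFilter U}.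
Hypothesis Uoo : \oo `<=` U.
Context {c : nat} (F : nat -> finite_mapping c).
Local Notation V n := (fm_dom (F n)).
Local Notation f n := (mfn (fm_map (F n))).
Local Notation lspace := (@lspace U c F).

Definition ext n : finType := (V n * bits n)%type.

Definition ext0 n : ext n := (upoint0 F n, [ffun => [ffun => false]]).

Definition ubase (y : forall n, ext n) : upoint F := fun n => (y n).1.

Definition ubit (y : forall n, ext n) l k : bool :=
  `[< U (fun n => bit (y n).2 l k) >].

Definition lbits_of (y : forall n, ext n) l k : bool :=
  ~~ `[< masked (@utype U c F (ubase y)) l >] && ubit y l k.

Lemma lbits_of_realized (y : forall n, ext n) :
  exists m, @utype U c F m = @utype U c F (ubase y).
Proof. by exists (ubase y). Qed.

Lemma lbits_of_masked y l : masked (@utype U c F (ubase y)) l ->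
  forall k, lbits_of y l k = false.
Proof. by move=> H k; rewrite /lbits_of asboolT. Qed.

Local Notation P := (@loeb R U UU Uoo ext ext0).

Definition sample (y : loeb_type ext0) : lspace :=
  LPoint (lbits_of_realized y) (@lbits_of_masked y).

Lemma measurable_utype D :
  measurable [set y : loeb_type ext0 | @utype U c F (ubase y) D].
Proof.
rewrite (_ : [set y | _] = @internal U ext ext0
    (fun n => [set x | x.1 \in den (fm_map (F n)) D]%SET)).
  exact: measurable_internal.
apply/seteqP; split=> y /=.
  by move/utypeP; apply: filterS => n; rewrite inE.
by move=> H; apply/utypeP; apply: filterS H => n; rewrite inE.
Qed.

Lemma measurable_masked l :
  measurable [set y : loeb_type ext0 | masked (@utype U c F (ubase y)) l].
Proof.
rewrite (_ : [set y | _] = \bigcup_(D in [set D | forces l D])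
    [set y : loeb_type ext0 | @utype U c F (ubase y) D]).
  rewrite bigcup_mkcond; apply: countable_bigcupT_measurable => // D.
  by case: ifP => // _; exact: measurable_utype.
by apply/seteqP; split=> y [D]; [move=> [lD yD]|move=> lD yD]; exists D.
Qed.

Lemma measurable_ubit l k : measurable [set y : loeb_type ext0 | ubit y l k].
Proof.
rewrite (_ : [set y | _] = @internal U ext ext0
    (fun n => [set x | bit x.2 l k]%SET)).
  exact: measurable_internal.
apply/seteqP; split=> y /=.
  by move/asboolP; apply: filterS => n; rewrite inE.
by move=> H; apply/asboolP; apply: filterS H => n; rewrite inE.
Qed.

Lemma measurable_sample : measurable_fun setT sample.
Proof.
apply: measurable_fun_lspace => -[D|[l k]] /=; first exact: measurable_utype.
rewrite (_ : [set z | _] =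
    (~` [set y : loeb_type ext0 | masked (@utype U c F (ubase y)) l]) `&`
    [set y : loeb_type ext0 | ubit y l k]).
  by apply: measurableI; [apply: measurableC; exact: measurable_masked|exact: measurable_ubit].
apply/seteqP; split=> y /=; rewrite /lbits_of.
  by move=> /andP[/asboolPn].
by move=> [m b]; rewrite b andbT; apply/asboolPn.
Qed.

HB.instance Definition _ := isMeasurableFun.Build _ _ _ _ sample measurable_sample.

Definition lmeasure : probability lspace R := distribution P sample.

Lemma lmeasureE A : lmeasure A = P (sample @^-1` A).
Proof. by []. Qed.

Section tuples.
Variable p : nat.

Definition text n : finType := p.-tuple (ext n).

Definition text0 n : text n := [tuple ext0 n | _ < p].

Definition component (a : 'I_p) : loeb_type text0 -> loeb_type ext0 :=
  @uprod_map U UU ext text ext0 text0 (fun n v => tnth v a).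

Definition tsample (y : loeb_type text0) : p.-tuple lspace :=
  [tuple sample (component a y) | a < p].

Definition tbase (y : loeb_type text0) : p.-tuple (upoint F) :=
  [tuple ubase (component a y) | a < p].

Lemma measurable_tsample : measurable_fun setT tsample.
Proof.
apply/measurable_fun_tnthP => a.
rewrite (_ : _ \o _ = sample \o component a).
  by apply: measurableT_comp; [exact: measurable_sample|exact: measurable_uprod_map].
by apply/funext => y /=; rewrite tnth_mktuple.
Qed.

End tuples.

Local Notation Pt p := (@loeb R U UU Uoo (text p) (text0 p)).

(** Tuples are drawn from the Loeb space of tuples, where formulas in several variables define
    internal sets; [loeb_prod] and uniqueness of product measures show that the entries are
    independent. *)
Lemma loeb_tsample p (A : set (p.-tuple lspace)) : measurable A ->
  Pt p (@tsample p @^-1` A) = product_power lmeasure p A.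
Proof.
elim: p A => [|p IH] A mA.
  rewrite /= diracE; have [A0|A0] := boolP ([tuple] \in A).
    rewrite (_ : _ @^-1` _ = setT) ?probability_setT//.
    apply/seteqP; split=> // y _ /=; rewrite (tuple0 (tsample y)).
    by rewrite inE in A0.
  rewrite (_ : _ @^-1` _ = set0) ?measure0//.
  apply/seteqP; split=> // y /=; rewrite (tuple0 (tsample y)) => A0'.
  by move/negP: A0; apply; rewrite inE.
pose h1 := @uprod_map U UU ext (text p.+1) ext0 (text0 p.+1) (fun n v => thead v).
pose h2 := @uprod_map U UU (text p) (text p.+1) (text0 p) (text0 p.+1)
  (fun n v => [tuple of behead v]).
pose th y := (sample (h1 y), tsample (h2 y)).
have mth : measurable_fun setT th.
  apply: measurable_fun_pair.
    by apply: (measurableT_comp measurable_sample); exact: measurable_uprod_map.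
  have mh2 : measurable_fun setT h2 by exact: measurable_uprod_map.
  exact: (measurableT_comp (@measurable_tsample p) mh2).
have tsE y : tsample y = cons_pair (th y).
  apply: eq_from_tnth => a; rewrite tnth_mktuple.
  case: (unliftP ord0 a) => [b|] ->; last by rewrite tnth0.
  rewrite tnthS tnth_mktuple; congr sample; apply: functional_extensionality_dep => n.
  by rewrite /component /uprod_map /h2 /uprod_map [in LHS](tuple_eta (y n)) tnthS.
have mC : measurable (@cons_pair _ lspace p @^-1` A).
  by rewrite -[X in measurable X]setTI; exact: measurable_cons_pair.
transitivity (pushforward (Pt p.+1) th (@cons_pair _ lspace p @^-1` A)).
  by rewrite /pushforward; congr (Pt p.+1 _); apply/seteqP; split=> y /=; rewrite tsE.
apply/esym; apply: product_measure_unique => // B C mB mC'.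
apply: (etrans _ (congr1 (fun t => lmeasure B * t)%E (IH C mC'))).
rewrite lmeasureE /pushforward.
rewrite -(@loeb_prod R U UU Uoo ext (text p) (text p.+1) ext0 (text0 p) (text0 p.+1)
  (fun n v => thead v) (fun n v => [tuple of behead v])).
- by [].
- by move=> n D E; exact: card_tuple_cons.
- by move=> n; rewrite /text !card_tuple expnS.
- by rewrite -[X in measurable X]setTI; exact: measurable_sample.
- by rewrite -[X in measurable X]setTI; exact: measurable_tsample.
Qed.

(** * Almost sure agreement of coincidence patterns *)

Section almost_everywhere.
Variable p : nat.

Lemma le_loeb_internal (W : forall n, {set text p n}) k : (0 < k)%N ->
  U (fun n => #|W n| * k <= #|ext n| ^ p)%N ->
  (Pt p (internal W) <= (k%:R^-1)%:E)%E.
Proof.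
move=> k0 H; rewrite loebE lee_fin; apply: density_le; first exact: text0.
apply: filterS H => n; rewrite -(ler_nat R) natrM /ratio card_tuple => Hn.
have e0 : (0 : R) < (#|ext n| ^ p)%:R.
  by rewrite ltr0n expn_gt0; apply/orP; left; apply/card_gt0P; exists (ext0 n).
by rewrite ler_pdivrMr// ler_pdivlMl ?ltr0n// mulrC.
Qed.

Lemma loeb_null (N : set (loeb_type (text0 p))) (g : nat -> nat) :
  measurable N -> (forall k, (k < g k)%N) ->
  (forall k, exists2 W, N `<=` internal W & U (fun n => #|W n| * g k <= #|ext n| ^ p)%N) ->
  Pt p N = 0%E.
Proof.
move=> mN gk H; apply/eqP; rewrite eq_le measure_ge0 andbT.
apply/lee_addgt0Pr => e e0; rewrite add0e.
pose k := Num.bound e^-1.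
have e1 : (0 <= e^-1)%R by rewrite invr_ge0 ltW.
have ek : (e^-1 < k%:R)%R := archi_boundP e1.
have kp : (0 < k%:R :> R)%R := le_lt_trans e1 ek.
have [W NW HW] := H k.
have k0 : (0 < g k)%N by apply: leq_ltn_trans (gk k).
apply: (@le_trans _ _ (Pt p (internal W))).
  by apply: le_measure; rewrite ?inE//; exact: measurable_internal.
apply: (le_trans (le_loeb_internal k0 HW)); rewrite lee_fin.
rewrite invf_ple ?posrE ?ltr0n//; apply: le_trans (ltW ek) _.
by rewrite ler_nat ltnW.
Qed.

(** Only meeting at a light vertex is harmful: heavy vertices are named, and there both sides
    agree. *)
Definition merged_base (a b : 'I_p) (i j : nat) : set (loeb_type (text0 p)) :=
  [set y | ueq (U := U) (iter i (@umap c F) (ubase (component a y)))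
                        (iter j (@umap c F) (ubase (component b y))) /\
    forall k, ~~ @utype U c F (iter i (@umap c F) (ubase (component a y))) (CHeavy i k)].

Lemma merged_base_internal a b i j k :
  exists2 W, merged_base a b i j `<=` internal W &
    measurable (merged_base a b i j) /\
    (a != b -> U (fun n => #|W n| * k <= #|ext n| ^ p)%N).
Proof.
pose W k n : {set text p n} := [set v | (iter i (f n) (tnth v a).1 == iter j (f n) (tnth v b).1)
  && (iter i (f n) (tnth v a).1 \notin den (fm_map (F n)) (CHeavy i k))]%SET.
have E : merged_base a b i j = \bigcap_k (@internal U (text p) (text0 p) (W k)).
  apply/seteqP; split=> y.
    move=> [e H] k' _; have := H k'; rewrite -utypeN => /utypeP H'.
    apply: filterS (filterI e H') => n []; rewrite !iter_umapE => e' h'.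
    rewrite finset.in_set; apply/andP; split; first exact/eqP.
    by move: h'; rewrite [den _ _]/= finset.in_setC.
  move=> H; split.
    by apply: filterS (H 0%N I) => n; rewrite inE !iter_umapE => /andP[/eqP].
  move=> k'; rewrite -utypeN; apply/utypeP; apply: filterS (H k' I) => n.
  rewrite finset.in_set iter_umapE => /andP[_ h].
  by rewrite [den _ _]/= finset.in_setC.
exists (W k); first by rewrite E; exact: bigcap_inf.
split; first by rewrite E; apply: bigcap_measurableType => // k' _; exact: measurable_internal.
move=> ab; apply: filterE => n; apply: (@card_tset _ _ _ a) => v.
set w := iter j (f n) (tnth v b).1.
have sub : [set x | tset a x v \in W k n]%SET \subset
    [set x : ext n | (iter i (f n) x.1 == w) && (w \notin den (fm_map (F n)) (CHeavy i k))]%SET.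
  apply/fintype.subsetP => x; rewrite !finset.in_set tnth_tset (tnth_tset_neq _ _ ab).
  by move=> /andP[/eqP-> ->]; rewrite eqxx.
apply: leq_trans (leq_mul (subset_leq_card sub) (leqnn k)) _.
have [wH|wH] := boolP (w \in den (fm_map (F n)) (CHeavy i k)).
  rewrite (_ : [set x | _]%SET = finset.set0) ?cards0//.
  by apply/setP => x; rewrite !inE andbF.
rewrite (_ : [set x | _]%SET = finset.setX [set x | iter i (f n) x == w]%SET [set: bits n]%SET).
  rewrite cardsX cardsT card_prod mulnAC leq_mul2r; apply/orP; right.
  by rewrite mulnC; exact: card_CHeavy.
by apply/setP => -[x1 x2]; rewrite !inE !andbT.
Qed.

Definition merged_rows (a b : 'I_p) (l l' : nat) : set (loeb_type (text0 p)) :=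
  [set y | forall k, ubit (component a y) l k = ubit (component b y) l' k].

(** With all samples but the [a]-th fixed, [K] bits of one row are prescribed, as soon as [n] is
    large enough for them to exist. *)
Lemma merged_rows_internal a b l l' K :
  exists2 W, merged_rows a b l l' `<=` internal W &
    measurable (merged_rows a b l l') /\
    (a != b -> U (fun n => #|W n| * 2 ^ K <= #|ext n| ^ p)%N).
Proof.
pose W K n : {set text p n} :=
  [set v | [forall k : 'I_K, bit (tnth v a).2 l k == bit (tnth v b).2 l' k]]%SET.
have E : merged_rows a b l l' = \bigcap_K (@internal U (text p) (text0 p) (W K)).
  apply/seteqP; split=> y.
    move=> H K' _.
    have : U (fun n => forall k, k \in iota 0 K' ->
        bit (tnth (y n) a).2 l k = bit (tnth (y n) b).2 l' k).
      apply: ultra_all => k _; have := H k.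
      have [/asboolP ba|/asboolPn na] := boolP (ubit (component a y) l k) => /esym.
        by move=> /asboolP bb; apply: filterS (filterI ba bb) => n [-> ->].
      move=> /negbT/asboolPn nb.
      have na' : U (fun n => ~ bit (tnth (y n) a).2 l k) by exact/ultraN.
      have nb' : U (fun n => ~ bit (tnth (y n) b).2 l' k) by exact/ultraN.
      by apply: filterS (filterI na' nb') => n [/negP/negbTE-> /negP/negbTE->].
    apply: filterS => n H'; rewrite inE; apply/forallP => k.
    by apply/eqP; apply: H'; rewrite mem_iota leq0n add0n ltn_ord.
  move=> H k; have Hk : U (fun n => bit (tnth (y n) a).2 l k = bit (tnth (y n) b).2 l' k).
    apply: filterS (H k.+1 I) => n; rewrite inE => /forallP/(_ ord_max)/eqP.
    exact.
  by apply/asboolP/asboolP => h; apply: filterS (filterI Hk h) => n [e];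
    rewrite /component /uprod_map e.
exists (W K); first by rewrite E; exact: bigcap_inf.
split; first by rewrite E; apply: bigcap_measurableType => // k' _; exact: measurable_internal.
move=> ab; apply: filterS (filterI (ultra_ge Uoo l) (ultra_ge Uoo K)) => n [ln Kn].
apply: (@card_tset _ _ _ a) => v.
have sub : [set x | tset a x v \in W K n]%SET \subset
    finset.setX [set: V n]%SET
      [set w | [forall k : 'I_K, bit w l k == bit (tnth v b).2 l' k]]%SET.
  apply/fintype.subsetP => x; rewrite !inE => /forallP H; apply/forallP => k.
  by have := H k; rewrite tnth_tset (tnth_tset_neq _ _ ab).
apply: leq_trans (leq_mul (subset_leq_card sub) (leqnn _)) _.
rewrite cardsX cardsT card_prod -mulnA leq_mul2l; apply/orP; right.
apply: (@card_bits_prefix n l (fun k => bit (tnth v b).2 l' k)) => //.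
by rewrite ltnS leqW.
Qed.

(** If no iterate of [z] is named, row 0 survives and is shared. Otherwise take the iterate just
    before the first named one: a rank would name it too, so its row 1 survives, and it is a row of
    both samples. *)
Lemma sample_merged_rows y a b z i j : z = iter i (@lmap U UU c F) (sample (component a y)) ->
  z = iter j (@lmap U UU c F) (sample (component b y)) ->
  (forall s D, ~~ ltype z (CNth s D)) ->
  exists l l', merged_rows a b l l' y.
Proof.
set xa := sample _ => za; set xb := sample _ => zb nz.
have named_iter (x : lpoint F) r : named (ltype (iter r (@lmap U UU c F) x)) <-> named (ltype x).
  elim: r => //= r <-; have [m <-] := lrealized (iter r (@lmap U UU c F) x).
  exact: named_shift.
have masked_iter (x : lpoint F) r :
    masked (ltype (iter r (@lmap U UU c F) x)) 1 <-> masked (ltype x) r.+1.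
  elim: r x => // r IH x; rewrite iterSr IH; exact: masked_shift.
have rowE (a' : 'I_p) l k : ~ masked (ltype (sample (component a' y))) l ->
    lbits (sample (component a' y)) l k = ubit (component a' y) l k.
  by move=> H; rewrite /= /lbits_of asboolF.
have [nm|nm] := pselect (named (ltype z)); last first.
  exists 0%N, 0%N => k; rewrite -!rowE.
  - by rewrite -/xa -/xb -(lbits_iter0 i xa) -(lbits_iter0 j xb) -za -zb.
  - by move/masked0; rewrite -/xb -(named_iter xb j) -zb.
  - by move/masked0; rewrite -/xa -(named_iter xa i) -za.
have [r [s [D rz]]] := nm.
pose Q r := `[< exists s D, ltype (iter r (@lmap U UU c F) z) (CNth s D) >].
have exQ : exists r, Q r by exists r; apply/asboolP; exists s, D; rewrite ltype_iter.
case: (ex_minnP exQ) => -[|r'] /asboolP[s' [D' Hr]] minr.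
  by have := nz s' D'; rewrite Hr.
pose z' := iter r' (@lmap U UU c F) z.
have nmask : ~ masked (ltype z') 1.
  move=> [_ [[j' [E ->]] zE]]; have [m mz] := lrealized z'.
  have : utype (U := U) m (CNth 0 (CAnd (CRank j' E) (CPre (CNth s' D')))).
    apply: utype_CNth_CRank_pre; last by rewrite mz.
    by rewrite utype_umap mz.
  rewrite mz => H; have : Q r' by apply/asboolP; do 2 eexists; exact: H.
  by move/minr; rewrite ltnn.
have za' : z' = iter (r' + i) (@lmap U UU c F) xa by rewrite iterD -za.
have zb' : z' = iter (r' + j) (@lmap U UU c F) xb by rewrite iterD -zb.
exists (r' + i).+1, (r' + j).+1 => k; rewrite -!rowE.
- have ea := lbits_iterS (r' + i) xa 0; have eb := lbits_iterS (r' + j) xb 0.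
  by rewrite !addn0 in ea eb; rewrite -/xa -/xb -ea -eb -za' -zb'.
- by rewrite -/xb -masked_iter -zb'.
- by rewrite -/xa -masked_iter -za'.
Qed.

Lemma conf_sample y :
  (forall a b i j, a != b -> ~ merged_base a b i j y) ->
  (forall a b l l', a != b -> ~ merged_rows a b l l' y) ->
  conf (tsample y) (tbase y).
Proof.
move=> nM nL; split=> [a|a b i j]; rewrite !tnth_mktuple//.
have [->|ab] := eqVneq a b; first exact: lmap_iter_eq.
set xa := sample (component a y); set xb := sample (component b y).
have [[s [D xD]]|na] := pselect (exists s D, ltype (iter i (@lmap U UU c F) xa) (CNth s D)).
  exact: named_iter_eq xD.
split=> [e|e].
  have [||l [l']] := @sample_merged_rows y a b _ i j erefl; [exact: e| |].
    by move=> s D; apply/negP => xD; apply: na; exists s, D.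
  by move/(nL a b l l' ab).
(* A meeting point that is heavy is one of at most [k] vertices, hence the [s]-th of them for a
   fixed [s] on a set of [U]: a named point. *)
exfalso; apply: (nM a b i j ab); split=> // k; apply/negP => /utypeP H; apply: na.
set w := iter i (@umap c F) (ubase (component a y)) in H *.
have : U (fun n => exists2 s, (s < k)%N & w n \in den (fm_map (F n)) (CNth s (CHeavy i k))).
  apply: filterS H => n wH; exists (position (den (fm_map (F n)) (CHeavy i k)) (w n)).
    apply: leq_trans (position_lt wH) _; apply: card_den_CHeavy.
    exact: fm_dom_gt0.
  by rewrite [den _ (CNth _ _)]/= inE eqxx andbT.
move=> /ultra_exists_lt[s _ Hs]; exists s, (CHeavy i k).
have tE : utype (U := U) (ubase (component a y)) = ltype xa by [].
by rewrite -(ltype_iter_utype i tE); apply/utypeP.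
Qed.

Lemma conf_negligible : (Pt p).-negligible (~` [set y | conf (tsample y) (tbase y)]).
Proof.
pose I := (('I_p * 'I_p * (nat * nat)) * bool)%type.
pose N (z : I) : set (loeb_type (text0 p)) :=
  let: (a, b, (i, j), q) := z in
  if a == b then set0 else if q then merged_base a b i j else merged_rows a b i j.
have nN z : (Pt p).-negligible (N z).
  case: z => [[[a b] [i j]] q] /=; case: eqVneq => [_|ab]; first exact: negligible_set0.
  case: q; apply/negligibleP.
  - by have [W _ []] := merged_base_internal a b i j 0.
  - apply: (@loeb_null _ succn) => //.
      by have [W _ []] := merged_base_internal a b i j 0.
    by move=> k; have [W sW [_ /(_ ab) HW]] := merged_base_internal a b i j k.+1; exists W.
  - by have [W _ []] := merged_rows_internal a b i j 0.
  - apply: (@loeb_null _ (expn 2)) => //.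
      by have [W _ []] := merged_rows_internal a b i j 0.
    by move=> k; exact: ltn_expl.
    by move=> k; have [W sW [_ /(_ ab) HW]] := merged_rows_internal a b i j k; exists W.
have := @negligible_bigcup _ _ _ (Pt p) (fun k => if @pickle_inv I k is Some z then N z else set0).
move=> H; apply: negligibleS (H _); last first.
  by move=> k; case: pickle_inv => [z|]; [exact: nN|exact: negligible_set0].
move=> y ny; apply: contrapT => H'; apply: ny; apply: conf_sample => a b i j ab yN; apply: H'.
  by exists (pickle ((a, b, (i, j), true) : I)) => //; rewrite pickleK_inv /= (negbTE ab).
by exists (pickle ((a, b, (i, j), false) : I)) => //; rewrite pickleK_inv /= (negbTE ab).
Qed.

End almost_everywhere.
End limit_measure.

(** * Stone pairings, theory and atoms of the limit *)

Section limit_properties.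
Context (R : realType) {U : set_system nat} {UU : UltraFilter U}.
Hypothesis Uoo : \oo `<=` U.
Context {c : nat} (F : nat -> finite_mapping c).
Local Notation V n := (fm_dom (F n)).
Local Notation f n := (mfn (fm_map (F n))).
Local Notation lspace := (@lspace U c F).
Local Notation ML := (@lmapping U UU c F : mapping c lspace).
Local Notation nu := (@lmeasure R U UU Uoo c F).

Lemma measure_eq_negligible d (T : measurableType d) (mu : probability T R)
    (A B : set T) : measurable A -> measurable B ->
  mu.-negligible [set x | ~ (A x <-> B x)] -> mu A = mu B.
Proof.
move=> mA mB [N [mN N0 AN]].
suff le A' B' : measurable A' -> measurable B' ->
    [set x | ~ (A' x <-> B' x)] `<=` N -> (mu A' <= mu B')%E.
  apply/eqP; rewrite eq_le le//= le// => x /= H; apply: AN => /= -[a b].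
  by apply: H.
move=> mA' mB' sN; apply: (@le_trans _ _ (mu (B' `|` N))).
  apply: le_measure; rewrite ?inE//; first exact: measurableU.
  move=> x Ax; have [Bx|nBx] := pselect (B' x); [by left|right].
  by apply: sN => -[/(_ Ax)].
rewrite -[leRHS]adde0 -[X in (_ + X)%E]N0; exact: measureU2.
Qed.

(** The random bits contribute the same factor to numerator and denominator. *)
Lemma pairing_internal p (phi : formula c p) :
  @loeb R U UU Uoo (text F p) (text0 F p)
    (internal (fun n => [set v | `[< sat (fm_map (F n)) phi (map_tuple fst v) >]]%SET))
  = (ulim (U := U) (fun n => finite_pairing R phi (F n)))%:E.
Proof.
rewrite loebE /density; congr (@ulim R U _)%:E; apply/funext => n.
rewrite /ratio /finite_pairing (@card_tuple_pair _ _ _ (fun v => `[< sat (fm_map (F n)) phi v >])).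
rewrite /text card_tuple card_prod expnMn !natrM !natrX.
rewrite -mulf_div divff ?mulr1; last first.
  rewrite expf_neq0// pnatr_eq0 -lt0n; apply/card_gt0P.
  by exists [ffun => [ffun => false]].
by congr (_%:R / _); apply: eq_card => v; rewrite !inE.
Qed.

Lemma product_power_sat p (phi : formula c p) :
  product_power nu p [set X | sat ML phi X] =
  (ulim (U := U) (fun n => finite_pairing R phi (F n)))%:E.
Proof.
rewrite -pairing_internal -loeb_tsample; last exact: measurable_sat.
apply: measure_eq_negligible.
- rewrite -[X in measurable X]setTI; apply: measurable_tsample => //.
  exact: measurable_sat.
- exact: measurable_internal.
apply: negligibleS (@conf_negligible R U UU Uoo c F p) => y /= H Hc; apply: H.
rewrite (sat_conf Uoo phi Hc).
have E n : utuple (tbase y) n = map_tuple fst (y n).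
  by apply: eq_from_tnth => a; rewrite !tnth_map tnth_ord_tuple.
by split; apply: filterS => n; rewrite E inE; [move=> H; apply/asboolP|move/asboolP].
Qed.

(** [U] refines the filter at infinity, so the ultralimit is the ordinary limit. *)
Lemma FO_limit_lmeasure : FO_convergent R F -> FO_limit F nu ML.
Proof.
move=> Fcvg p phi; have Fl := Fcvg p phi.
rewrite /modeling_pairing product_power_sat /=.
rewrite (_ : ulim _ = lim ((fun n => finite_pairing R phi (F n)) @ \oo)); first exact: Fl.
apply: ulimE => A HA; apply: Uoo; exact: Fl.
Qed.

(** A sentence true in [L] has pairing 1, which is not the limit of a sequence of zeros. *)
Lemma fmp_lmeasure : FO_limit F nu ML -> finite_model_property ML.
Proof.
move=> lim theta Mt; have := lim 0%N theta.
have -> : modeling_pairing nu ML theta = 1.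
  rewrite /modeling_pairing.
  change (fine (\d_([tuple] : 0.-tuple lspace) [set v | sat ML theta v]) = 1 :> R).
  by rewrite diracE mem_set.
move=> cv; apply: contrapT => /forallNP H.
have : (fun n => finite_pairing R theta (F n)) = cst 0.
  apply/funext => n; rewrite /finite_pairing (_ : #|_| = 0%N) ?mul0r//.
  apply: eq_card0 => v; rewrite inE; apply/asboolPn => Hv; apply: (H (F n)).
  by rewrite /models -(tuple0 v).
move=> E; rewrite E in cv.
have cv0 : (cst 0 : nat -> R) @ \oo --> (0 : R) by exact: cvg_cst.
have e10 : (1 : R) = 0.
  by apply: (@cvg_unique R _ ((cst 0 : nat -> R) @ \oo)) => //; exact: Rhausdorff.
by have := oner_neq0 R; rewrite e10 eqxx.
Qed.

Lemma measurable_lpoint (x : lspace) : measurable [set x].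
Proof.
rewrite (_ : [set x] = [set y | id y = cst x y]) //.
by apply: measurable_lspace_eq; [exact: measurable_id|exact: measurable_cst].
Qed.

Lemma product_power_cons p (A : set lspace) (B : set (p.-tuple lspace)) :
  measurable A -> measurable B ->
  (product_power nu p.+1 [set X | A (thead X) /\ B [tuple of behead X]] =
   nu A * product_power nu p B)%E.
Proof.
move=> mA mB; rewrite -(product_measure1E nu (product_power nu p) mA mB).
change ((nu \x product_power nu p)%E (@cons_pair _ lspace p @^-1`
  [set X | A (thead X) /\ B [tuple of behead X]]) =
  (nu \x product_power nu p)%E (A `*` B)).
have bK (x : lspace) (X : p.-tuple lspace) : [tuple of behead [tuple of x :: X]] = X.
  exact: val_inj.
by congr ((_ \x _)%E _); apply/seteqP; split=> -[x X] /=; rewrite theadE bK.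
Qed.

Hypothesis Finfty : (fun n => #|fm_dom (F n)|) @ \oo --> \oo.

(** The formula [x = y] has pairing [1/|F_n|], so the diagonal is null for the square of [nu]; it
    contains the square of each singleton. *)
Lemma atomless_lmeasure : FO_limit F nu ML -> atomless nu.
Proof.
move=> lim x; pose phi : formula c 2 := FEq c (TVar ord0) (TVar (lift ord0 ord0)).
have := lim 2%N phi.
have c0 : (fun n => finite_pairing R phi (F n)) @ \oo --> (0 : R).
  have E n : finite_pairing R phi (F n) = #|V n|%:R^-1.
    rewrite /finite_pairing (_ : #|_| = #|V n|).
      rewrite expr2 invfM mulrA divff ?mul1r//.
      by rewrite pnatr_eq0 -lt0n fm_dom_gt0.
    pose g (v : V n) : 2.-tuple (V n) := [tuple v; v].
    have gi : injective g by move=> v w /(congr1 (fun t => thead t)).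
    rewrite -(card_imset _ gi); apply: eq_card => v; rewrite inE.
    apply/asboolP/imsetP => [/= e|[w _ ->] //].
    exists (tnth v ord0) => //; apply: eq_from_tnth => i.
    by case: (unliftP ord0 i) => [j|] -> //; rewrite (ord1 j) -e.
  under eq_fun do rewrite E.
  apply/cvgrPdist_lt => e e0; near=> n; rewrite sub0r normrN ger0_norm ?invr_ge0//.
  have Vn : (0 < #|V n|%:R :> R) by rewrite ltr0n fm_dom_gt0.
  rewrite invf_plt ?posrE//; apply: lt_le_trans (archi_boundP _) _.
    by rewrite invr_ge0 ltW.
  rewrite ler_nat; near: n; exact: (Finfty (nbhs_infty_ge _)).
move=> c1; have E0 : 0 = modeling_pairing nu ML phi.
  by apply: (@cvg_unique R _ ((fun n => finite_pairing R phi (F n)) @ \oo)) => //;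
    exact: Rhausdorff.
have sat0 : product_power nu 2 [set X : 2.-tuple lspace | sat ML phi X] = 0%E.
  have : product_power nu 2 [set X : 2.-tuple lspace | sat ML phi X] \is a fin_num.
    by apply: fin_num_measure; exact: measurable_sat.
  by move=> /fineK <-; rewrite -/(modeling_pairing nu ML phi) -E0.
have mx := measurable_lpoint x.
pose B : set (1.-tuple lspace) := [set X | [set x] (thead X) /\ setT [tuple of behead X]].
have mB : measurable B.
  rewrite (_ : B = (@tnth 1 lspace ^~ ord0) @^-1` [set x]).
    by rewrite -[X in measurable X]setTI; exact: measurable_tnth.
  by apply/seteqP; split=> X; [move=> []|split].
have sq : (nu [set x] * nu [set x] = 0)%E.
  apply/eqP; rewrite eq_le mule_ge0// andbT -sat0.
  have -> : (nu [set x] * nu [set x] =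
      product_power nu 2 [set X | [set x] (thead X) /\ B [tuple of behead X]])%E.
    rewrite product_power_cons// product_power_cons//.
    by rewrite probability_setT mule1.
  apply: le_measure; rewrite ?inE; last 2 first.
  - exact: measurable_sat.
  - move=> X [/= X0 [/= X1 _]]; transitivity x; first exact: X0.
    by rewrite -X1 [in RHS](tuple_eta X) tnthS.
  rewrite (_ : [set X | _] = (@tnth 2 lspace ^~ ord0) @^-1` [set x] `&`
      (fun X : 2.-tuple lspace => [tuple of behead X]) @^-1` B)//.
  apply: measurableI; rewrite -[X in measurable X]setTI.
    exact: measurable_tnth.
  exact: measurable_behead.
by move/eqP: sq; rewrite mule_eq0 orbb => /eqP.
Unshelve. all: by end_near.
Qed.

End limit_properties.

(** * Mass transport *)

Section shift.
Variable n : nat.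

(** Row 1, which [lmap] forgets, reappears as the last row, beyond any fixed index for large [n].
    Being a permutation, the shift keeps uniform bits uniform. *)
Definition shift_row (l : 'I_n.+2) : 'I_n.+2 :=
  inord (if l == 0 :> nat then 0 else if l == n.+1 :> nat then 1 else l.+1).

Lemma shift_rowE (l : 'I_n.+2) :
  shift_row l = (if l == 0 :> nat then 0 else if l == n.+1 :> nat then 1 else l.+1) :> nat.
Proof.
rewrite /shift_row inordK//; case: eqP => // _; case: eqP => // /eqP ln.
by have := ltn_ord l; rewrite !ltnS leq_eqVlt (negbTE ln).
Qed.

Lemma shift_row_inj : injective shift_row.
Proof.
move=> l l' /(congr1 val); rewrite /= !shift_rowE => H; apply: val_inj => /=.
by move: H (ltn_ord l) (ltn_ord l'); do !case: eqP; lia.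
Qed.

Definition shift_bits_fin (w : bits n) : bits n := [ffun l => w (shift_row l)].

Lemma shift_bits_fin_bij : bijective shift_bits_fin.
Proof.
have [g shK gK] := injF_bij shift_row_inj.
exists (fun w : bits n => [ffun l => w (g l)]) => w; apply/ffunP => l.
  by rewrite !ffunE gK.
by rewrite !ffunE shK.
Qed.

Lemma bit_shift w l k : (l < n.+1)%N ->
  bit (shift_bits_fin w) l k = bit w (if l is 0 then 0 else l.+1)%N k.
Proof.
move=> ln; have ln1 : (l < n.+2)%N by rewrite ltnW.
have rl : ((if l is 0 then 0 else l.+1) < n.+2)%N by case: l ln ln1.
rewrite /bit (insubT (fun l => l < n.+2)%N ln1) (insubT (fun l => l < n.+2)%N rl).
case: insub => // k'; rewrite ffunE; congr (w _ _); apply: val_inj => /=.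
rewrite shift_rowE /=; case: l ln ln1 rl => //= l ln _ _.
by rewrite eqSS; case: eqP => // e; move: ln; rewrite e ltnn.
Qed.

End shift.

Section transport.
Context (R : realType) {U : set_system nat} {UU : UltraFilter U}.
Hypothesis Uoo : \oo `<=` U.
Context {c : nat} (F : nat -> finite_mapping c).
Local Notation V n := (fm_dom (F n)).
Local Notation f n := (mfn (fm_map (F n))).
Local Notation lspace := (@lspace U c F).
Local Notation ML := (@lmapping U UU c F : mapping c lspace).
Local Notation lmap := (@lmap U UU c F).
Local Notation umap := (@umap c F).
Local Notation nu := (@lmeasure R U UU Uoo c F).
Local Notation P := (@loeb R U UU Uoo (ext F) (ext0 F)).
Local Notation T := (@loeb_type U UU (ext F) (ext0 F)).

Local Notation sample := (@sample U UU c F).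

Definition ext_map n (z : ext F n) : ext F n := (f n z.1, shift_bits_fin z.2).

Definition sample_map : T -> T := @uprod_map U UU (ext F) (ext F) (ext0 F) (ext0 F) ext_map.

(** Erasure commutes with the shift, and at a fixed row the wrap-around is invisible for large
    [n]. *)
Lemma sample_mapE y : sample (sample_map y) = lmap (sample y).
Proof.
have tE : utype (U := U) (ubase (sample_map y)) = shift_type (utype (U := U) (ubase y)).
  by rewrite -utype_umap.
apply: lpoint_eq => //; apply/funext => l; apply/funext => k.
rewrite /= /shift_bits /lbits_of tE; congr (~~ _ && _).
  apply: asbool_equiv_eq; case: l => [|l]; last exact: masked_shift.
  by rewrite !masked0; exact: named_shift.
by apply/asboolP/asboolP => H; apply: filterS (filterI (ultra_ge Uoo l) H) => n [ln];
  rewrite /sample_map /uprod_map /ext_map /= bit_shift.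
Qed.

Definition ranked j : set lspace := [set x | ltype x (CRank j CTrue)].

Definition child_above j : set lspace := [set y | ltype y (CIm (CRank j CTrue))].

(** [ext_map] is injective on the [j]-th siblings, and its image consists of the points over
    vertices with more than [j] children. *)
Lemma card_ext_map j n (A : {set ext F n}) :
  #|[set z | (z.1 \in den (fm_map (F n)) (CRank j CTrue)) && (ext_map z \in A)]%SET| =
  #|[set z in A | z.1 \in den (fm_map (F n)) (CIm (CRank j CTrue))]%SET|.
Proof.
have [g gK Kg] := shift_bits_fin_bij n.
set S := [set z | _]%SET.
have inj : {in S &, injective (@ext_map n)}.
  move=> [x w] [x' w']; rewrite finset.in_set => /andP[xR _].
  rewrite finset.in_set => /andP[x'R _].
  move=> [fx /(can_inj gK) ->].
  by have -> : x = x' := den_CRank_eq xR x'R fx.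
rewrite -(card_in_imset inj); apply: eq_card => z; rewrite finset.in_set.
apply/imsetP/andP => [[z' + ->]|[zA /imsetP[x xR zx]]].
  by rewrite finset.in_set => /andP[z'R z'A]; split=> //; exact: imset_f.
exists (x, g z.2); last by rewrite /ext_map /= -zx Kg; case: (z).
rewrite finset.in_set /= xR /ext_map /= -zx Kg.
by move: zA; case: (z).
Qed.

(** The finite counts give equality on internal sets of the Loeb space, and both sides are finite
    measures there. *)
Lemma transport_ranked j (B : set lspace) : measurable B ->
  nu (ranked j `&` lmap @^-1` B) = nu (B `&` child_above j).
Proof.
move=> mB.
have msm : measurable_fun setT sample_map by exact: measurable_uprod_map.
pose Rt : set T := [set y | utype (U := U) (ubase y) (CRank j CTrue)].
pose Dt : set T := [set y | utype (U := U) (ubase y) (CIm (CRank j CTrue))].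
have mR : measurable Rt by exact: measurable_utype.
have mD : measurable Dt by exact: measurable_utype.
suff main (A : set T) : measurable A -> P (sample_map @^-1` A `&` Rt) = P (A `&` Dt).
  rewrite !lmeasureE -[RHS](main (sample @^-1` B)); last first.
    by rewrite -[X in measurable X]setTI; exact: measurable_sample.
  congr (P _); apply/seteqP; split=> y.
    by move=> [yR yB]; split=> //; rewrite /preimage /= sample_mapE.
  by move=> [yB yR]; split=> //; move: yB; rewrite /preimage /= sample_mapE.
move=> mA.
transitivity (pushforward (mrestr P mR) sample_map A) => //.
transitivity (mrestr P mD A) => //.
apply: loeb_ext => //; last first.
  rewrite /pushforward /mrestr; apply: (@le_lt_trans _ _ 1%E); last exact: ltry.
  by apply: probability_le1; rewrite preimage_setT setTI.
move=> W; change (P (sample_map @^-1` internal W `&` Rt) = P (internal W `&` Dt)).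
have -> : sample_map @^-1` internal W `&` Rt = @internal U (ext F) (ext0 F) (fun n =>
    [set z | (z.1 \in den (fm_map (F n)) (CRank j CTrue)) && (ext_map z \in W n)]%SET).
  apply/seteqP; split=> y.
    move=> [yW /utypeP yR]; apply: filterS (filterI yW yR) => n [a b].
    by rewrite finset.in_set; apply/andP.
  move=> H; split; first by apply: filterS H => n; rewrite finset.in_set => /andP[].
  by apply/utypeP; apply: filterS H => n; rewrite finset.in_set => /andP[].
have -> : internal W `&` Dt = @internal U (ext F) (ext0 F) (fun n =>
    [set z in W n | z.1 \in den (fm_map (F n)) (CIm (CRank j CTrue))]%SET).
  apply/seteqP; split=> y.
    move=> [yW /utypeP yR]; apply: filterS (filterI yW yR) => n [a b].
    by rewrite finset.in_set; apply/andP.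
  move=> H; split; first by apply: filterS H => n; rewrite finset.in_set => /andP[].
  by apply/utypeP; apply: filterS H => n; rewrite finset.in_set => /andP[].
rewrite !loebE; congr (_%:E); apply: density_near; first exact: ext0.
by apply: filterE => n; rewrite /ratio card_ext_map.
Qed.

Lemma measurable_ranked j : measurable (ranked j).
Proof. exact: measurable_ltype. Qed.

Lemma measurable_child_above j : measurable (child_above j).
Proof. exact: measurable_ltype. Qed.

Lemma conf1_ex (x : lpoint F) : exists m, conf [tuple x] [tuple m].
Proof.
have [M] := conf_forth_tuple Uoo [tuple x]; case/tupleP: M => m M.
by rewrite (tuple0 M); exists m.
Qed.

(** The types are not assumed equal, so the pair is carried to the ultraproduct, where rank and
    image force equality. *)
Lemma ranked_inj j (x x' : lspace) : ranked j x -> ranked j x' ->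
  lmap x = lmap x' -> x = x'.
Proof.
move=> xR x'R xx'; have [m xm] := conf1_ex x; have [m' [t e]] := conf_forth Uoo xm x'.
have mR : utype (U := U) m (CRank j CTrue).
  by have := xm.1 ord0; rewrite !tnth0 => ->.
have m'R : utype (U := U) m' (CRank j CTrue) by rewrite t.
have mm' : ueq (U := U) (umap m') (umap m).
  by have := (e ord0 1%N 1%N).1; rewrite /= !tnth0; apply; exact/esym.
have := (e ord0 0%N 0%N).2; rewrite /= !tnth0 => -> //.
exact: utype_CRank_ueq m'R mR mm'.
Qed.

Lemma child_ex (y : lspace) D : ltype y (CIm D) ->
  exists x : lspace, lmap x = y /\ ltype x D.
Proof.
move=> yD; have [m ym] := conf1_ex y.
have tm : utype (U := U) m = ltype y by have := ym.1 ord0; rewrite !tnth0.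
have [v Hv] : exists v : upoint F,
    U (fun n => v n \in den (fm_map (F n)) D /\ m n = f n (v n)).
  apply: (ultra_exists (upoint0 F) (fun n w => w \in den (fm_map (F n)) D /\ m n = f n w)).1.
  move: yD; rewrite -tm => /utypeP; apply: filterS => n /imsetP[w wD mw].
  by exists w.
have [x [tx ex]] := conf_back ym v; exists x; split; last first.
  by rewrite -tx; apply/utypeP; apply: filterS Hv => n [].
apply: (ex ord0 1%N 0%N).2; rewrite /= tnth0.
by apply: filterS Hv => n [_ ->].
Qed.

Lemma ltype_lmap_CIm (x : lspace) D : ltype x D -> ltype (lmap x) (CIm D).
Proof.
rewrite -[ltype (lmap x)]/(shift_type (ltype x)); have [m <-] := lrealized x.
by move=> /utype_CIm; rewrite utype_umap.
Qed.

Lemma ranked_child_above j (x : lspace) : ranked j x -> child_above j (lmap x).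
Proof. exact: ltype_lmap_CIm. Qed.

Lemma ranked_ex (x : lspace) k : ~ child_above k (lmap x) ->
  exists2 j, (j < k)%N & ranked j x.
Proof.
have [m mx] := lrealized x.
rewrite /child_above /ranked /= -mx -utype_umap => /negP.
rewrite -utypeN => /utypeP H.
have [j jk Hj] : exists2 j, (j < k)%N &
    U (fun n => m n \in den (fm_map (F n)) (CRank j CTrue)).
  apply: ultra_exists_lt; apply: filterS H => n.
  rewrite [den _ (CNot _)]/= finset.in_setC -/(den _ (CIm (CRank k CTrue))) den_CIm_CRank -leqNgt.
  set E := [set _ in _ | _]%SET => Ek.
  have mE : m n \in E by rewrite finset.in_set eqxx andbT; exact: denT.
  exists (position E (m n)); first exact: leq_trans (position_lt mE) Ek.
  by rewrite den_CRankE eqxx andbT; exact: denT.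
by exists j => //; apply/utypeP.
Qed.

Lemma ranked_disjoint i j (x : lspace) : ranked i x -> ranked j x -> i = j.
Proof.
have [m mx] := lrealized x; rewrite /ranked /= -mx => /utypeP Hi /utypeP Hj.
apply: (@ultra_const U UU (i = j)).1; apply: filterS (filterI Hi Hj) => n [].
by rewrite !den_CRankE => /andP[_ /eqP <-] /andP[_ /eqP <-].
Qed.

(** A fibre holds at most one point of each rank, and a missing rank [k] bounds all its ranks by
    [k]. *)
Lemma infinite_fibersE : infinite_fibers ML = \bigcap_j child_above j.
Proof.
apply/seteqP; split=> y; last first.
  move=> H fin.
  have ex j : exists x, lmap x = y /\ ranked j x by exact: child_ex (H j I).
  have [g Hg] := choice ex.
  have gi : {in setT &, injective g}.
    move=> i j _ _ gij; have [_ gi] := Hg i; have [_ gj] := Hg j.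
    by apply: (ranked_disjoint gi); rewrite gij.
  have : finite_set (g @` setT).
    by apply: sub_finite_set fin => _ [j _ <-]; have [] := Hg j.
  by rewrite (eq_finite_set (inj_card_eq gi)); exact: infinite_nat.
move=> inf k _; apply: contrapT => yk; apply: inf.
pose S j := [set x : lspace | lmap x = y /\ ranked j x].
apply: (@sub_finite_set _ _ (\bigcup_(j in `I_k) S j)).
  move=> x /= xy; have [|j jk xj] := @ranked_ex x k; first by rewrite xy.
  by exists j.
apply: bigcup_finite => [|j _]; first exact: finite_II.
have [[x Sx]|nS] := pselect (exists x, S j x).
  apply: (@sub_finite_set _ _ [set x]); last exact: finite_set1.
  by move=> x' [x'y x'j]; apply: (ranked_inj x'j Sx.2); rewrite x'y Sx.1.
rewrite (_ : S j = set0); first exact: finite_set0.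
by apply/seteqP; split=> // x Sx; apply: nS; exists x.
Qed.

Definition nth_child j (y : lspace) : lspace :=
  if pselect (exists x : lspace, lmap x = y /\ ranked j x) is left H then sval (cid H)
  else y.

Lemma nth_childP j y : child_above j y ->
  lmap (nth_child j y) = y /\ ranked j (nth_child j y).
Proof.
move=> yj; rewrite /nth_child; case: pselect => [H|[]]; first exact: (svalP (cid H)).
exact: child_ex.
Qed.

Lemma nth_child_lmap j x : ranked j x -> nth_child j (lmap x) = x.
Proof.
move=> xj; have [e r] := nth_childP (ranked_child_above xj).
exact: (ranked_inj r xj e).
Qed.

Lemma nth_child_out j y : ~ child_above j y -> nth_child j y = y.
Proof.
move=> ny; rewrite /nth_child; case: pselect => // -[x [xy xj]].
by exfalso; apply: ny; rewrite -xy; exact: ranked_child_above.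
Qed.

(** The coordinates of the child are read off [y]: a code through the image of its intersection with
    rank [j], row 1 as erased by the rank, and the remaining rows as rows of [y]. *)
Lemma measurable_nth_child j : measurable_fun setT (nth_child j).
Proof.
apply: measurable_fun_lspace => i.
pose C : set lspace := match i with
  | inl D => [set y | ltype y (CIm (CAnd (CRank j CTrue) D))]
  | inr (0, k) => [set y | lbits y 0 k]
  | inr (1, k) => set0
  | inr (l.+2, k) => [set y | lbits y l.+1 k]
  end.
have mC : measurable C.
  by case: (i) @C => [D|[[|[|l]] k]] //=; [exact: measurable_ltype|exact: measurable_lbits..].
rewrite (_ : [set z | _] = (child_above j `&` C) `|`
    (~` child_above j `&` [set z | lcoord i z])).
  apply: measurableU; apply: measurableI => //.
  - exact: measurable_child_above.
  - by apply: measurableC; exact: measurable_child_above.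
  - exact: measurable_lcoord.
suff key y : child_above j y -> lcoord i (nth_child j y) <-> C y.
  apply/seteqP; split=> y.
    have [yj|yj] := pselect (child_above j y); first by move=> /(key y yj); left.
    by rewrite /= nth_child_out//; right.
  move=> [[yj /(key y yj)//]|[yj]].
  by rewrite /= nth_child_out.
move=> yj; have [e r] := nth_childP yj; set x := nth_child j y in e r *.
case: i @C {mC} => [D|[[|[|l]] k]] /=.
- split=> [xD|/child_ex[x' [x'y x'D]]].
    rewrite -e; apply: ltype_lmap_CIm; have [m mx] := lrealized x.
    have /utypeP mr : utype (U := U) m (CRank j CTrue) by rewrite mx.
    have /utypeP mD : utype (U := U) m D by rewrite mx.
    rewrite -mx; apply/utypeP; apply: filterS (filterI mr mD) => n [a b].
    by rewrite den_CAndE a b.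
  have [m mx] := lrealized x'; move: x'D; rewrite -mx => /utypeP x'D.
  have x'j : ranked j x'.
    rewrite /ranked /= -mx; apply/utypeP; apply: filterS x'D => n.
    by case/den_CAndP.
  rewrite (ranked_inj r x'j) ?e ?x'y// -mx; apply/utypeP; apply: filterS x'D => n.
  by case/den_CAndP.
- by rewrite -[in X in _ <-> X]e.
- split=> // H; have := lmasked (l := 1) (masked_rank r) k.
  by rewrite H.
- by rewrite -[in X in _ <-> X]e.
Qed.

(** The set lies in every [child_above j], which has the measure of [ranked j]; the latter are
    disjoint inside a space of mass 1. *)
Lemma infinite_fibers_null : nu (infinite_fibers ML) = 0%E.
Proof.
rewrite infinite_fibersE; set N := \bigcap_j _.
have mN : measurable N by apply: bigcap_measurableType => // j _; exact: measurable_child_above.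
have le_rank j : (nu N <= nu (ranked j))%E.
  rewrite (_ : ranked j = ranked j `&` lmap @^-1` setT); last by rewrite preimage_setT setIT.
  rewrite transport_ranked// setTI; apply: le_measure; rewrite ?inE//.
    exact: measurable_child_above.
  exact: bigcap_inf.
have sumN k : (k%:R%:E * nu N <= nu (\bigcup_(j < k) ranked j))%E.
  elim: k => [|k IH]; first by rewrite mul0e.
  have -> : \bigcup_(j < k.+1) ranked j = \bigcup_(j < k) ranked j `|` ranked k.
    by rewrite !bigcup_mkord big_ord_recr.
  rewrite measureU; last 3 first.
  - by apply: bigcup_measurable => j _; exact: measurable_ranked.
  - exact: measurable_ranked.
  - apply/seteqP; split=> // x [[j /= jk xj] xk].
    by move: jk; rewrite (ranked_disjoint xj xk) ltnn.
  rewrite -natr1 EFinD ge0_muleDl ?lee_fin//; apply: leeD => //.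
  by rewrite mul1e; exact: le_rank.
have Nfin : nu N \is a fin_num by exact: fin_num_measure.
apply/eqP; rewrite eq_le measure_ge0 andbT leNgt; apply/negP => N0.
move: sumN; rewrite -(fineK Nfin) => sumN.
have r0 : 0 < fine (nu N) by rewrite fine_gt0// N0/= ltey_eq Nfin.
have := sumN (Num.bound (fine (nu N))^-1); apply/negP; rewrite -ltNge.
apply: (@le_lt_trans _ _ 1%E).
  by apply: probability_le1; apply: bigcup_measurable => j _; exact: measurable_ranked.
rewrite -EFinM lte_fin -ltr_pdivrMr// mul1r.
by apply: archi_boundP; rewrite invr_ge0 ltW.
Qed.

Lemma mass_transport_lmeasure : finitary_mass_transport nu ML.
Proof.
split; first exact: infinite_fibers_null.
move=> A B mA mB _ Bfin.
(* Summed over [j], the indicators of these sets count the children lying in [A]. *)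
pose E j := child_above j `&` nth_child j @^-1` A.
have mE j : measurable (E j).
  apply: measurableI; first exact: measurable_child_above.
  by rewrite -[X in measurable X]setTI; exact: measurable_nth_child.
have rankB x : B (lmap x) -> exists j, ranked j x.
  move=> /Bfin; rewrite infinite_fibersE => H.
  have [k nk] : exists k, ~ child_above k (lmap x).
    by apply: contrapT => /forallNP H'; apply: H => k _; apply: contrapT; exact: H'.
  by have [j _ xj] := ranked_ex nk; exists j.
have mlB : measurable (lmap @^-1` B : set lspace).
  by rewrite -[X in measurable X]setTI; exact: measurable_lmap.
transitivity (\sum_(0 <= j <oo) nu (B `&` E j))%E.
  have -> : A `&` lmap @^-1` B = \bigcup_j (ranked j `&` (A `&` lmap @^-1` B)).
    apply/seteqP; split=> x; last by move=> [j _ []].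
    by move=> [xA xB]; have [j xj] := rankB x xB; exists j.
  rewrite measure_semi_bigcup//.
  - apply: eq_eseriesr => j _.
    (* For a point of rank [j], lying in [A] amounts to having its image in [E j], so the condition
       on the point becomes one on its image and can be transported. *)
    transitivity (nu (ranked j `&` lmap @^-1` (B `&` E j))); last first.
      apply: etrans (transport_ranked _ _) _; first exact: measurableI.
      by congr (nu _); apply/seteqP; split=> y; [move=> []|move=> [yB [yj yA]]].
    congr (nu _); apply/seteqP; split=> x [xj [a b]]; split=> //.
      split=> //; split; first exact: ranked_child_above.
      by rewrite /preimage /= nth_child_lmap.
    by move: b => [_]; rewrite /preimage /= nth_child_lmap.
  - by move=> j; apply: measurableI; [exact: measurable_ranked|exact: measurableI].
  - apply/trivIsetP => i j _ _ ij; apply/seteqP; split=> // x [[xi _] [xj _]].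
    by move/eqP: ij; apply; exact: ranked_disjoint xi xj.
  - apply: bigcupT_measurable => j; apply: measurableI; first exact: measurable_ranked.
    exact: measurableI.
transitivity (\int[nu]_(y in B) (\sum_(0 <= j <oo) (\1_(E j) y)%:E))%E.
  rewrite integral_nneseries//; last 1 first.
  - by move=> j; apply/measurable_EFinP; exact: measurable_indic.
  by apply: eq_eseriesr => j _; rewrite integral_indic// setIC.
apply: eq_integral => y /set_mem yB.
have -> : lmap @^-1` [set y] `&` A = \bigcup_j [set x | E j y /\ x = nth_child j y].
  apply/seteqP; split=> x.
    move=> [/= xy xA]; have [j xj] : exists j, ranked j x by apply: rankB; rewrite xy.
    have e : nth_child j y = x by rewrite -xy nth_child_lmap.
    exists j => //=; split=> //; split; last by rewrite /preimage /= e.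
    by rewrite -xy; exact: ranked_child_above.
  move=> [j _ [[yj yA] ->]]; split=> //; exact: (nth_childP yj).1.
have mS j : measurable [set x | E j y /\ x = nth_child j y].
  have [yE|nE] := pselect (E j y).
    rewrite (_ : [set x | _] = [set nth_child j y]); first exact: measurable_lpoint.
    by apply/seteqP; split=> x; [move=> []|move=> ->].
  rewrite (_ : [set x | _] = set0)//.
  by apply/seteqP; split=> // x [].
rewrite (measure_semi_bigcup (counting : measure lspace R))//; last 2 first.
- apply/trivIsetP => i j _ _ ij; apply/seteqP; split=> // x [[[yi _] xi] [[yj _] xj]].
  move/eqP: ij; apply; apply: (@ranked_disjoint i j x).
    by rewrite xi; exact: (nth_childP yi).2.
  by rewrite xj; exact: (nth_childP yj).2.
- exact: bigcupT_measurable.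
apply: eq_eseriesr => j _; rewrite /= indicE.
have [yE|nE] := pselect (E j y).
  rewrite mem_set// (_ : [set x | _] = [set nth_child j y]).
    rewrite /counting asboolT; last exact: finite_set1.
    by rewrite fset_set1 finmap.cardfs1.
  by apply/seteqP; split=> x; [move=> []|move=> ->].
rewrite memNset// (_ : [set x | _] = set0); last by apply/seteqP; split=> // x [].
by rewrite /counting asboolT ?fset_set0.
Qed.

End transport.

Theorem theorem1 (R : realType) (c : nat) (F : nat -> finite_mapping c)
    (Finfty : (fun n => #|fm_dom (F n)|) @ \oo --> \oo)
    (Fcvg : FO_convergent R F) :
  exists (d : measure_display) (L : measurableType d) (nu : probability L R)
         (ML : mapping c L),
    [/\ modeling_mapping R ML,
        FO_limit F nu ML,
        atomless nu,
        finite_model_property ML &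
        finitary_mass_transport nu ML].
Proof.
have [U [UU Uoo]] := ultraFilterLemma (eventually_filter : ProperFilter \oo).
pose L : measurableType _ := @lspace U c F.
pose nu : probability L R := @lmeasure R U UU Uoo c F.
pose ML : mapping c L := @lmapping U UU c F.
have lim : FO_limit F nu ML by exact: FO_limit_lmeasure.
exists _, L, nu, ML; split.
- exact: modeling_lspace.
- exact: lim.
- exact: atomless_lmeasure.
- exact: fmp_lmeasure lim.
- exact: mass_transport_lmeasure.
Qed.
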